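(* Let $B$ be a supersoluble brace. Then $B$ has a chain of ideals $$\{0\}=I_{0,0}\le I_{0,1}\le\dots\le I_{0,\ell}=I_{1,0}\le I_{1,1}\le\dots\le I_{1,m}=I_{2,0}\le I_{2,1}\le\dots\le I_{2,n}=B$$ such that: $|I_{0,i+1}/I_{0,i}|$ is an odd prime for all $0\le i<\ell$; $|I_{0,i+1}/I_{0,i}|\ge|I_{0,i+2}/I_{0,i+1}|$ for all $0\le i<\ell-1$; $I_{1,i+1}/I_{1,i}\le\operatorname{Soc}(B/I_{1,i})$ and $(I_{1,i+1}/I_{1,i},+)$ is infinite cyclic for all $0\le i<m$; and $|I_{2,i+1}/I_{2,i}|=2$ for all $0\le i<n$.
   Context: A brace (skew left brace) is a set $B$ with two binary operations $+$ and $\cdot$ such that $(B,+)$ and $(B,\cdot)$ are groups and $a(b+c)=ab-a+ac$ for all $a,b,c\in B$. For $a,b\in B$ put $\lambda_a(b)=-a+ab$; $\lambda\colon(B,\cdot)\to\operatorname{Aut}(B,+)$ is a homomorphism. An ideal of $B$ is a subset that is a subgroup of both groups, normal in $(B,+)$ and in $(B,\cdot)$, and invariant under all $\lambda_b$ ($b\in B$); quotients $B/I$ by ideals are braces. $\operatorname{Soc}(B)=\operatorname{Ker}\lambda\cap Z(B,+)$. A brace $B$ is supersoluble if there is a finite chain of ideals $\{0\}=I_0\le\dots\le I_n=B$ such that for each $i$, either $(I_{i+1}/I_i,+)$ is infinite cyclic and $I_{i+1}/I_i\le\operatorname{Soc}(B/I_i)$, or $I_{i+1}/I_i$ has prime order.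 *)

(* Defs.v *)
From mathcomp Require Import all_boot.
From mathcomp Require Import all_algebra.

Set Implicit Arguments.
Unset Strict Implicit.
Unset Printing Implicit Defensive.

(** A (skew left) brace: a type with two group structures (+ possibly
    non-commutative) satisfying a(b+c) = ab - a + ac. *)
Record brace := Brace {
  car :> Type;
  badd : car -> car -> car;
  bopp : car -> car;
  bzero : car;
  bmul : car -> car -> car;
  binv : car -> car;
  bone : car;
  baddA : forall a b c, badd a (badd b c) = badd (badd a b) c;
  badd0 : forall a, badd bzero a = a;
  baddN : forall a, badd (bopp a) a = bzero;
  bmulA : forall a b c, bmul a (bmul b c) = bmul (bmul a b) c;
  bmul1 : forall a, bmul bone a = a;
  bmulV : forall a, bmul (binv a) a = bone;
  bmulD : forall a b c,
    bmul a (badd b c) = badd (badd (bmul a b) (bopp a)) (bmul a c)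
}.

Section BraceDefs.
Variable B : brace.

Definition blam (a b : B) : B := badd (bopp a) (bmul a b).

Definition is_ideal (I : B -> Prop) : Prop :=
  (I (bzero B) /\ (forall x y, I x -> I y -> I (badd x y))
     /\ (forall x, I x -> I (bopp x))) /\
  (I (bone B) /\ (forall x y, I x -> I y -> I (bmul x y))
     /\ (forall x, I x -> I (binv x))) /\
  (forall b x, I x -> I (badd (badd b x) (bopp b))) /\
  (forall b x, I x -> I (bmul (bmul b x) (binv b))) /\
  (forall b x, I x -> I (blam b x)).

Definition congr_mod (J : B -> Prop) (x y : B) : Prop := J (badd (bopp x) y).

Fixpoint nmul (g : B) (n : nat) : B :=
  match n with 0 => bzero B | n'.+1 => badd g (nmul g n') end.
Definition zmul (g : B) (z : int) : B :=
  match z with Posz n => nmul g n | Negz n => bopp (nmul g n.+1) end.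

Definition quot_card (I J : B -> Prop) (k : nat) : Prop :=
  exists f : 'I_k -> B,
    [/\ forall i, I (f i),
        forall i j, congr_mod J (f i) (f j) -> i = j
      & forall x, I x -> exists i, congr_mod J (f i) x].

Definition quot_inf_cyclic (I J : B -> Prop) : Prop :=
  exists g, [/\ I g,
    forall x, I x -> exists z : int, congr_mod J (zmul g z) x
  & forall z : int, J (zmul g z) -> z = 0%R].

(** I/J <= Soc(B/J) = Ker lambda ∩ Z(B/J,+), stated on representatives. *)
Definition quot_in_soc (I J : B -> Prop) : Prop :=
  forall x, I x -> forall b,
    congr_mod J (blam x b) b /\ congr_mod J (badd x b) (badd b x).

Definition ideal_chain (I : nat -> B -> Prop) (len : nat) : Prop :=
  [/\ forall x, I 0 x <-> x = bzero B,
      forall x, I len x,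
      forall k, k <= len -> is_ideal (I k)
    & forall k x, k < len -> I k x -> I k.+1 x].

Definition supersoluble : Prop :=
  exists (len : nat) (I : nat -> B -> Prop),
    ideal_chain I len /\
    forall i, i < len ->
      (quot_inf_cyclic (I i.+1) (I i) /\ quot_in_soc (I i.+1) (I i))
      \/ (exists p, prime p /\ quot_card (I i.+1) (I i) p).

End BraceDefs.

(* Main.v *)
(* Passing to a quotient brace B/J, two adjacent factors of a chain J <= K <= I that are in the
   wrong order can be exchanged.
   - Orders p < q: a prime q cannot act nontrivially on K, so I is abelian for both operations,
     and its q-torsion is an ideal complementing K.
   - Infinite cyclic below odd q: I is again abelian for both operations; either its q-torsion
     complements K, or I itself is infinite cyclic and contained in the socle.
   - Order 2 below infinite cyclic: 4I is an ideal meeting K trivially and contained in the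
     socle, at the price of three factors of order 2 above it.
   Adding the factors of a given chain one at a time and moving each one down to its place by
   these exchanges (an insertion sort) yields the required chain. *)
From HB Require Import structures.
Require Import Defs.
From mathcomp Require Import all_boot.
From mathcomp Require Import all_algebra.
From mathcomp Require Import fingroup perm action cyclic boolp zify.

Set Implicit Arguments.
Unset Strict Implicit.
Unset Printing Implicit Defensive.

Import GRing.Theory.

(** * Groups *)

(** Moving a factor of prime order q down requires its action on the factor K below to be trivial.
    If K has order p < q, the action permutes p points with trivial q-th power, so it is the
    identity; if K is infinite cyclic, the action is 1 or -1, and q odd excludes -1. Triviality
    makes K central, and I/K is cyclic, so I is abelian in both groups; this is what makes the
    q-torsion a subgroup. An infinite cyclic factor above a K of order 2 needs another device:
    elements of I may move b by the nonzero element of K, and passing to 4I cancels these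
    deviations. Exchanges change the number of factors: an odd factor may be absorbed, and factors
    of order 2 may multiply. The sort therefore recurses on the already sorted part of the chain,
    and the new factors of order 2 arise above the infinite factor, where they belong. *)

Section FiniteIterates.
Local Open Scope group_scope.

(** Point stabilisers in the group generated by [s] are trivial, so every orbit has exactly #[s]
    points. *)
Lemma perm_semiregular_order (T : finType) (s : {perm T}) :
  (forall m x, (s ^+ m) x = x -> s ^+ m = 1) -> #[s] %| #|T|.
Proof.
move=> free; rewrite -cardsT.
have actT : [acts <[s]>, on [set: T] | 'P].
  by apply/actsP=> a _ x; rewrite !inE.
rewrite -(acts_sum_card_orbit actT); apply: dvdn_sum => _ /imsetP[x _ ->].
rewrite card_orbit (_ : 'C_<[s]>[x | 'P] = 1) ?indexg1 //.
apply/trivgP/subsetP=> _ /setIP[/cycleP[m ->] /astab1P /= fix_x].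
by rewrite inE; apply/eqP; apply: (free m x).
Qed.

(** The order of [s] divides both q and n!, and a prime q > n does not divide n!. *)
Lemma perm_small_prime_period (n q : nat) (s : {perm 'I_n}) :
  prime q -> n < q -> s ^+ q = 1 -> s = 1.
Proof.
move=> q_pr ltnq sq1; apply/eqP; rewrite -order_eq1.
have : #[s] %| q by rewrite order_dvdn sq1.
case/primeP: (q_pr) => _ dq /dq /orP[// | /eqP oq].
have : #[s] %| n`! by rewrite -card_Sn -cardsT order_dvdG ?inE.
rewrite oq; elim: n {s sq1 dq oq} ltnq => [|n IHn] ltnq.
  by rewrite Euclid_dvd1.
by rewrite factS Euclid_dvdM // => /orP[/dvdn_leq|/IHn]; lia.
Qed.

End FiniteIterates.

Section Groups.
Local Open Scope group_scope.
Variable G : groupType.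
Implicit Types (H K : G -> Prop) (x y g k : G) (m n p q : nat) (a b : int).

Definition zpow x (a : int) : G :=
  match a with Posz n => x ^+ n | Negz n => x ^- n.+1 end.

Lemma zpow_subn x m n : zpow x (m%:Z - n%:Z)%R = x ^+ m * x ^- n.
Proof.
case: (leqP n m) => [lenm|ltmn].
  by rewrite subzn //= expgnFr.
rewrite (_ : (_ - _)%R = Negz (n - m).-1); last by lia.
rewrite /= prednK ?subn_gt0 // expgnFr ?(ltnW ltmn) //.
by rewrite invgM invgK.
Qed.

(** Differences of naturals avoid the sign cases in [zpowD] and [zpowM]. *)
Lemma zpow_subnP a : exists m n, a = (m%:Z - n%:Z)%R.
Proof. by case: a => n; [exists n, 0 | exists 0, n.+1]; lia. Qed.

Lemma zpowD x a b : zpow x (a + b)%R = zpow x a * zpow x b.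
Proof.
have [m [n ->]] := zpow_subnP a; have [m' [n' ->]] := zpow_subnP b.
rewrite (_ : (_ + _)%R = (m + m')%:Z - (n + n')%:Z)%R; last by lia.
rewrite !zpow_subn (addnC n) !expgnDr invgM !mulgA; congr (_ * _).
rewrite -!mulgA; congr (_ * _).
by apply: commuteV; apply: commuteX2.
Qed.

Lemma zpowN x a : zpow x (- a)%R = (zpow x a)^-1.
Proof. by apply: (mulgI (zpow x a)); rewrite -zpowD subrr mulgV. Qed.

Lemma zpowMn x a n : zpow x (a * n%:Z)%R = zpow x a ^+ n.
Proof.
elim: n => [|n IHn]; first by rewrite mulr0.
by rewrite expgS -IHn -zpowD; congr (zpow x _); lia.
Qed.

Lemma zpowM x a b : zpow x (a * b)%R = zpow (zpow x a) b.
Proof.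
have [m [n ->]] := zpow_subnP b.
by rewrite zpow_subn mulrBr zpowD zpowN !zpowMn.
Qed.

Lemma zpow_commute x y a : commute x y -> commute x (zpow y a).
Proof. by case: a => n xy; [exact: commuteX | exact/commuteV/commuteX]. Qed.

Lemma zpow_inj_gen g : (forall a, zpow g a = 1 -> a = 0%R) -> injective (zpow g).
Proof.
move=> gfree a b gab; apply/eqP; rewrite -subr_eq0; apply/eqP/gfree.
by rewrite zpowD zpowN gab mulgV.
Qed.

Definition subgroup H :=
  H 1 /\ (forall x y, H x -> H y -> H (x * y)) /\ (forall x, H x -> H x^-1).
Definition normal_subgroup H :=
  subgroup H /\ forall g x, H x -> H (g * x * g^-1).
Definition left_transversal H K n (f : 'I_n -> G) :=
  [/\ forall i, H (f i), forall i j, K ((f i)^-1 * f j) -> i = j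
    & forall x, H x -> exists i, K ((f i)^-1 * x)].
Definition centralizes H K := forall x y, H x -> K y -> commute x y.
Definition cyclic_mod H K g := H g /\ forall x, H x -> exists a, K ((zpow g a)^-1 * x).

Section SubgroupTheory.
Variables (H : G -> Prop) (sH : subgroup H).

Lemma subgroup1 : H 1. Proof. by case: sH. Qed.
Lemma subgroupM x y : H x -> H y -> H (x * y). Proof. by case: sH => _ [+ _]; apply. Qed.
Lemma subgroupV x : H x -> H x^-1. Proof. by case: sH => _ [_]; apply. Qed.
Lemma subgroupX x n : H x -> H (x ^+ n).
Proof.
move=> Hx; elim: n => [|n IHn]; first exact: subgroup1.
by rewrite expgS; apply: subgroupM.
Qed.
Lemma subgroup_zpow x a : H x -> H (zpow x a).
Proof. by case: a => n Hx; [|apply: subgroupV]; apply: subgroupX. Qed.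
Lemma subgroupMr x y : H y -> H (x * y) <-> H x.
Proof.
move=> Hy; split=> [Hxy|Hx]; last exact: subgroupM.
by rewrite -(mulgK y x); apply: subgroupM => //; apply: subgroupV.
Qed.
Lemma subgroupMl x y : H x -> H (x * y) <-> H y.
Proof.
move=> Hx; split=> [Hxy|Hy]; last exact: subgroupM.
by rewrite -(mulKg x y); apply: subgroupM => //; apply: subgroupV.
Qed.
Lemma subgroup_coprimeX x m n : coprime m n -> H (x ^+ m) -> H (x ^+ n) -> H x.
Proof.
(* [Bezoutl] needs a positive first argument; m = 0 forces n = 1. *)
case: m => [|m] co Hm Hn; first by move: co Hn; rewrite /coprime gcd0n => /eqP ->.
have [u _ /eqP] := @Bezoutl m.+1 n isT; rewrite (eqP co) => E.
have /dvdnP[v Ev] : m.+1 %| 1 + u * n by rewrite /dvdn E.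
have : H (x ^+ (v * m.+1)) by rewrite mulnC expgnA; exact: subgroupX.
rewrite -Ev expgnDr => /subgroupMr; apply.
by rewrite mulnC expgnA; exact: subgroupX.
Qed.

End SubgroupTheory.

(** Each element of H is a power of g times a central element, and such products commute. *)
Lemma cyclic_mod_abelian H K g :
  subgroup H -> cyclic_mod H K g -> (forall x, K x -> H x) -> centralizes K H ->
  centralizes H H.
Proof.
move=> sH [Hg gen] KH KcH.
have gc x : H x -> commute g x.
  move=> /[dup] Hx /gen [a Ka]; rewrite -(mulVKg (zpow g a) x).
  by apply: commuteM; [apply: zpow_commute | apply: commute_sym; apply: KcH].
move=> x y /[dup] Hx /gen [a Ka] Hy; rewrite -(mulVKg (zpow g a) x).
apply: commute_sym; apply: commuteM; last by apply: commute_sym; apply: KcH.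
by apply: zpow_commute; apply: commute_sym; apply: gc.
Qed.

(** Plays the part of Lagrange's theorem in H/K without constructing that group. Left translation by
    x permutes the n cosets; a power of x fixing one coset lies in K by normality, hence fixes all
    of them, so the order of this permutation divides n. *)
Lemma transversal_exponent H K n (f : 'I_n -> G) :
  subgroup H -> normal_subgroup K -> left_transversal H K f ->
  forall x, H x -> K (x ^+ n).
Proof.
move=> sH [sK nK] [Hf injf surjf] x Hx.
have [s0 s0P] : exists s : 'I_n -> 'I_n, forall i, K ((f (s i))^-1 * (x * f i)).
  apply: (@fin_all_exists _ _ (fun i j => K ((f j)^-1 * (x * f i)))) => i.
  exact: (surjf _ (subgroupM sH Hx (Hf i))).
have s_inj : injective s0.
  move=> i j eij; apply: injf.
  have := subgroupM sK (subgroupV sK (s0P i)) (s0P j).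
  by rewrite eij !invgM invgK !mulgA !mulgK mulgVK.
pose s := perm s_inj.
have sX m i : K ((f ((s ^+ m)%g i))^-1 * (x ^+ m * f i)).
  elim: m => [|m IHm] in i *; first by rewrite perm1 mul1g mulVg; apply: subgroup1.
  rewrite expgSr permM permE.
  have := subgroupM sK (s0P ((s ^+ m) i)) (IHm i).
  by rewrite expgS -!mulgA mulVKg.
have conjf y i : K ((f i)^-1 * (y * f i)) <-> K y.
  split=> [/(nK (f i))|/(nK (f i)^-1)]; last by rewrite invgK mulgA.
  by rewrite mulVKg mulgK.
have : #[s] %| n.
  rewrite -[n in _ %| n]card_ord; apply: perm_semiregular_order => m i fix_i.
  apply/permP=> j; rewrite perm1; apply: injf.
  have Km : K (x ^+ m) by apply/(conjf _ i); have := sX m i; rewrite fix_i.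
  have := subgroupM sK (sX m j) (subgroupV sK (proj2 (conjf _ j) Km)).
  by rewrite invgM invgK mulgA mulgK.
(* For n = 0 the power is 1; otherwise [ord0] is a coset at which to evaluate. *)
case: n => [|n] in f Hf injf surjf s0 s0P s_inj s sX conjf *.
  by rewrite expg0 => _; apply: subgroup1.
move=> /dvdnP[d ->]; rewrite mulnC expgnA; apply: (subgroupX sK).
apply/(conjf _ ord0); have := sX #[s] ord0.
by rewrite expg_order perm1.
Qed.

End Groups.

(** * Extensions of a subgroup by a cyclic quotient of prime order *)

Section PrimeIndex.
Local Open Scope group_scope.
Variable G : groupType.
Implicit Types (H K : G -> Prop) (x y g k : G) (m n p q : nat) (a b : int).

Lemma prime_transversal_proper H K q (f : 'I_q -> G) :
  prime q -> subgroup K -> left_transversal H K f -> exists2 x, H x & ~ K x.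
Proof.
move=> q_pr sK [Hf injf _]; have q_gt1 := prime_gt1 q_pr.
pose i := Ordinal (ltnW q_gt1); pose j := Ordinal q_gt1.
have [Ki|] := pselect (K (f i)); last by exists (f i).
have [Kj|] := pselect (K (f j)); last by exists (f j).
by have /(congr1 val) := injf i j (subgroupM sK (subgroupV sK Ki) Kj).
Qed.

(** The powers x^0, ..., x^(q-1) lie in distinct cosets: x^(j-i) and x^q in K with j - i prime to q
    would put x in K. An injection of ['I_q] into itself is onto, so these powers meet every
    coset. *)
Lemma prime_transversal_cyclic H K q (f : 'I_q -> G) x :
  prime q -> subgroup H -> normal_subgroup K -> left_transversal H K f ->
  H x -> ~ K x -> cyclic_mod H K x.
Proof.
move=> q_pr sH nK tf Hx nKx; split=> // y Hy.
have [sK _] := nK; have [Hf injf surjf] := tf.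
have [s sP] : exists s : 'I_q -> 'I_q, forall i, K ((f (s i))^-1 * x ^+ i).
  apply: (@fin_all_exists _ _ (fun i j : 'I_q => K ((f j)^-1 * x ^+ i))) => i.
  exact: (surjf _ (subgroupX sH i Hx)).
have s_lt (i j : 'I_q) : s i = s j -> i < j -> False.
  move=> sij lt_ij; apply: nKx.
  apply: (@subgroup_coprimeX _ _ sK x (j - i) q).
  - by rewrite coprime_sym prime_coprime // gtnNdvd //; have := ltn_ord j; lia.
  - have := subgroupM sK (subgroupV sK (sP i)) (sP j).
    rewrite sij invgM invgK -mulgA mulVKg -{1}(subnKC (ltnW lt_ij)) expgnDr.
    by rewrite mulKg.
  - exact: (transversal_exponent sH nK tf).
have s_inj : injective s.
  move=> i j sij; apply: val_inj.
  by case: (ltngtP i j) => // /s_lt; [move=> /(_ sij) | move=> /(_ (esym sij))].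
have [i Ki] := surjf y Hy.
have /codomP[j ej] := injF_onto s_inj i.
exists (j : nat); have := subgroupM sK (subgroupV sK (sP j)) Ki.
by rewrite -ej invgM invgK -mulgA mulVKg.
Qed.

(** Generic in the type and the unit, so that it is at once the trivial subgroup of either group and
    the zero ideal. *)
Definition triv (T : Type) (e x : T) := x = e.

Lemma normal_triv : normal_subgroup (triv (1 : G)).
Proof.
split=> [|g x ->]; last by rewrite mulg1 mulgV.
by split=> //; split=> [x y -> ->|x ->]; rewrite /triv ?mulg1 ?invg1.
Qed.

(** A transversal of K modulo 1 enumerates K, so [phi] becomes a permutation of p < q points with
    trivial q-th power. *)
Lemma small_prime_period K p q (f : 'I_p -> G) (phi : G -> G) :
  prime q -> p < q -> left_transversal K (triv 1) f ->
  (forall k, K k -> K (phi k)) -> (forall k, K k -> iter q phi k = k) ->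
  forall k, K k -> phi k = k.
Proof.
move=> q_pr ltpq [Kf injf surjf] Kphi phiq.
have surjf' k : K k -> exists i, f i = k.
  by move=> /surjf[i /(congr1 (mulg (f i)))]; rewrite mulVKg mulg1 => ->; exists i.
have [s0 s0P] : exists s0 : 'I_p -> 'I_p, forall i, f (s0 i) = phi (f i).
  apply: (@fin_all_exists _ _ (fun i j : 'I_p => f j = phi (f i))) => i.
  by apply: surjf'; apply: Kphi.
have iterK n k : K k -> K (iter n phi k) by move=> Kk; elim: n => //= n /Kphi.
have s0X n i : f (iter n s0 i) = iter n phi (f i).
  by elim: n => //= n <-.
have injf' i j : f i = f j -> i = j by move=> e; apply: injf; rewrite e mulVg.
have s0q i : iter q s0 i = i by apply: injf'; rewrite s0X phiq.
have s_inj : injective s0.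
  move=> i j; have := s0q j; have := s0q i; case: q q_pr {s0q ltpq phiq} => // q _.
  by rewrite !iterSr => {2}<- {2}<- ->.
have s1 : perm s_inj = 1.
  apply: (perm_small_prime_period q_pr ltpq); apply/permP=> i.
  rewrite permX perm1 -[RHS]s0q; apply: eq_iter => j; exact: permE.
move=> _ /surjf'[i <-]; rewrite -s0P; congr f.
by have := congr1 (fun t : {perm 'I_p} => t i) s1; rewrite permE perm1.
Qed.

(** The q-fold conjugation is conjugation by x^q, which lies in the abelian group K. *)
Lemma conj_prime_period H K q (f : 'I_q -> G) x k :
  subgroup H -> normal_subgroup K -> left_transversal H K f -> centralizes K K ->
  H x -> K k -> iter q (fun y => x * y * x^-1) k = k.
Proof.
move=> sH nK tf cKK Hx Kk.
have -> n : iter n (fun y => x * y * x^-1) k = x ^+ n * k * x ^- n.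
  elim: n => [|n IHn] /=; first by rewrite invg1 mul1g mulg1.
  by rewrite IHn expgS invgM !mulgA.
by rewrite (cKK _ _ (transversal_exponent sH nK tf Hx) Kk) mulgK.
Qed.

Lemma prime_order_abelian K p (f : 'I_p -> G) :
  prime p -> subgroup K -> left_transversal K (triv 1) f -> centralizes K K.
Proof.
move=> p_pr sK tf; have nT := normal_triv; have sT := proj1 nT.
have [x Kx nx] := prime_transversal_proper p_pr sT tf.
apply: (cyclic_mod_abelian sK (prime_transversal_cyclic p_pr sK nT tf Kx nx)).
  by move=> _ ->; apply: subgroup1.
by move=> _ y -> _; apply: commute_sym; apply: commute1.
Qed.

Lemma prime_index_abelian H K q (f : 'I_q -> G) :
  prime q -> subgroup H -> normal_subgroup K -> (forall x, K x -> H x) ->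
  left_transversal H K f -> centralizes K H -> centralizes H H.
Proof.
move=> q_pr sH nK KH tf KcH.
have [x Hx nKx] := prime_transversal_proper q_pr (proj1 nK) tf.
exact: (cyclic_mod_abelian sH (prime_transversal_cyclic q_pr sH nK tf Hx nKx)).
Qed.

(** Conjugation by an element of H has trivial q-th power on the p elements of K, so it is trivial
    there. Thus K is central in H, with cyclic quotient. *)
Lemma prime_by_larger_prime_abelian H K p q (f : 'I_p -> G) (h : 'I_q -> G) :
  prime p -> prime q -> p < q ->
  subgroup H -> normal_subgroup K -> (forall x, K x -> H x) ->
  left_transversal K (triv 1) f -> left_transversal H K h -> centralizes H H.
Proof.
move=> p_pr q_pr ltpq sH nK KH tf th; have [sK nrmK] := nK.
apply: (prime_index_abelian q_pr sH nK KH th) => k x Kk Hx.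
rewrite /commute -{1}(small_prime_period q_pr ltpq tf (nrmK x) _ Kk) ?mulgVK // => y Ky.
exact: (conj_prime_period sH nK th (prime_order_abelian p_pr sK tf)).
Qed.

Lemma prime_order_torsion K p q (f : 'I_p -> G) k :
  prime p -> prime q -> p < q -> subgroup K -> left_transversal K (triv 1) f ->
  K k -> k ^+ q = 1 -> k = 1.
Proof.
move=> p_pr q_pr ltpq sK tf Kk kq.
apply: (@subgroup_coprimeX _ _ (proj1 normal_triv) k q p) => //.
  by rewrite prime_coprime // gtnNdvd // prime_gt0.
exact: (transversal_exponent sK normal_triv tf).
Qed.

Lemma odd_expz_eq1 (a : int) q : odd q -> (a ^+ q)%R = 1%R -> a = 1%R.
Proof.
move=> oq aq; have : (`|a|%N ^ q = 1)%N by rewrite -abszX aq.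
move/eqP; rewrite -(exp1n q) eqn_exp2r; last by case: q oq {aq}.
move=> /eqP a1; move: aq; case: (intP a) a1 => [|n|n] //=; rewrite ?abszN /=.
  by case: n.
case: n => // _; rewrite -signr_odd oq; by [].
Qed.

(** [phi] multiplies exponents by a, so a^q = 1; oddness of q rules out a = -1. *)
Lemma infinite_cyclic_odd_period g (phi : G -> G) a q :
  (forall a, zpow g a = 1 -> a = 0%R) ->
  (forall b, phi (zpow g b) = zpow (phi g) b) -> phi g = zpow g a ->
  odd q -> iter q phi g = g -> phi g = g.
Proof.
move=> gfree phiz phig oq phiq.
have phiX n : iter n phi g = zpow g (a ^+ n)%R.
  elim: n => [|n IHn] //=.
  by rewrite IHn phiz phig -zpowM exprS.
rewrite phig (_ : a = 1%R) //; apply: (odd_expz_eq1 oq).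
by apply: (zpow_inj_gen gfree); rewrite -phiX.
Qed.

Lemma zpow_expg (x : G) a n : zpow x a ^+ n = zpow (x ^+ n) a.
Proof. by rewrite -zpowMn mulrC zpowM. Qed.

Lemma conj_expg (x y : G) n : (x * y * x^-1) ^+ n = x * y ^+ n * x^-1.
Proof. by have := conjXg y x^-1 n; rewrite !conjgE !invgK !mulgA. Qed.

(** Write x^q = g^n. If n = m q, then x g^-m is q-torsion, so x = g^m lies in K, a contradiction.
    Otherwise u n + v q = 1, and y = x^u g^v satisfies y^q = g. Any z in H has z^q = g^c = (y^c)^q,
    hence z = y^c since H has no q-torsion. *)
Lemma prime_index_infinite_cyclic (H K : G -> Prop) (g x : G) (q : nat) :
  prime q -> subgroup H -> subgroup K -> (forall x, K x -> H x) ->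
  centralizes H H -> (forall y, H y -> K (y ^+ q)) ->
  K g -> (forall y, K y -> exists a, zpow g a = y) ->
  (forall y, H y -> y ^+ q = 1 -> y = 1) -> H x -> ~ K x ->
  exists y, [/\ H y, y ^+ q = g & forall z, H z -> exists a, zpow y a = z].
Proof.
move=> q_pr sH sK KH cHH expq Kg gen tfree Hx nKx.
have Hg := KH _ Kg.
have [n en] := gen _ (expq x Hx).
have [/dvdzP[m em]|ndiv] := boolP (q %| n)%Z.
  case: nKx; rewrite -(mulgVK (zpow g m) x); apply: (subgroupMr sK _ _).2.
    exact: subgroup_zpow.
  rewrite (_ : x * _ = 1); first exact: subgroup1.
  have Hm : H (zpow g m)^-1 by apply: subgroupV => //; apply: subgroup_zpow.
  apply: tfree; first exact: subgroupM.
  rewrite expgMn; last exact: cHH.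
  by rewrite expVgn -zpowMn -em en mulgV.
have /coprimezP[[u v] /= uv] : coprimez n q%:Z.
  by rewrite /coprimez gcdzC -[_ == _]/(coprime q `|n|) prime_coprime.
exists (zpow x u * zpow g v).
have Hy : H (zpow x u * zpow g v) by apply: subgroupM => //; apply: subgroup_zpow.
have yq : (zpow x u * zpow g v) ^+ q = g.
  rewrite expgMn; last by apply: cHH; apply: subgroup_zpow.
  by rewrite zpow_expg -en -zpowM -zpowMn -zpowD (mulrC n) uv.
split=> // z Hz; have [c ec] := gen _ (expq z Hz); exists c.
have Hc := subgroup_zpow sH c Hy.
apply/eqP; rewrite -divg_eq1; apply/eqP; apply: tfree.
  by apply: subgroupM => //; apply: subgroupV.
rewrite expgMn; last by apply: cHH => //; apply: subgroupV.
by rewrite expVgn zpow_expg yq ec mulgV.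
Qed.

End PrimeIndex.

(** * Braces *)

Section LeftAxioms.
Variables (T : Type) (op : T -> T -> T) (inv : T -> T) (e : T).
Hypotheses (opA : associative op) (op1 : left_id e op) (opV : left_inverse e inv op).

(** [brace] records only left identities and left inverses, while [isGroup.Build] asks for both
    sides. *)
Lemma left_axioms_right_inverse : right_inverse e inv op.
Proof. by move=> x; rewrite -[LHS]op1 -{1}(opV (inv x)) -opA (opA (inv x)) opV op1 opV. Qed.

Lemma left_axioms_right_id : right_id e op.
Proof. by move=> x; rewrite -(opV x) opA left_axioms_right_inverse op1. Qed.
End LeftAxioms.

(* Two aliases of the carrier, since a type can bear only one canonical group structure. *)
Definition addg (B : brace) : Type := B.
Definition mulgp (B : brace) : Type := B.

HB.instance Definition _ (B : brace) := gen_eqMixin (addg B).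
HB.instance Definition _ (B : brace) := gen_choiceMixin (addg B).
HB.instance Definition _ (B : brace) := @isGroup.Build (addg B) (bzero B) (@bopp B) (@badd B)
  (@baddA B) (@badd0 B) (left_axioms_right_id (@baddA B) (@badd0 B) (@baddN B)) (@baddN B)
  (left_axioms_right_inverse (@baddA B) (@badd0 B) (@baddN B)).
HB.instance Definition _ (B : brace) := gen_eqMixin (mulgp B).
HB.instance Definition _ (B : brace) := gen_choiceMixin (mulgp B).
HB.instance Definition _ (B : brace) := @isGroup.Build (mulgp B) (bone B) (@binv B) (@bmul B)
  (@bmulA B) (@bmul1 B) (left_axioms_right_id (@bmulA B) (@bmul1 B) (@bmulV B)) (@bmulV B)
  (left_axioms_right_inverse (@bmulA B) (@bmul1 B) (@bmulV B)).

Declare Scope brace_scope.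
Delimit Scope brace_scope with br.
Notation "x + y" := (badd x y) : brace_scope.
Notation "- x" := (bopp x) : brace_scope.
Notation "x * y" := (bmul x y) : brace_scope.
Notation "x ^-1" := (binv x) : brace_scope.
Notation "0" := (bzero _) : brace_scope.
Notation "1" := (bone _) : brace_scope.

Section BraceTheory.
Variable B : brace.
Local Open Scope brace_scope.
Implicit Types (a b c x y k : B) (I J K Q : B -> Prop).

Let A := addg B.
Let M := mulgp B.

Lemma baddr0 a : a + 0 = a. Proof. exact: (@mulg1 A). Qed.
Lemma baddrN a : a + - a = 0. Proof. exact: (@mulgV A). Qed.
Lemma baddNKl a b : - a + (a + b) = b. Proof. exact: (@mulKg A). Qed.
Lemma baddKNl a b : a + (- a + b) = b. Proof. exact: (@mulVKg A). Qed.
Lemma baddKr a b : b + a + - a = b. Proof. exact: (@mulgK A). Qed.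
Lemma baddNKr a b : b + - a + a = b. Proof. exact: (@mulgVK A). Qed.
Lemma oppbD a b : - (a + b) = - b + - a. Proof. exact: (@invgM A). Qed.
Lemma oppbK a : - - a = a. Proof. exact: (@invgK A). Qed.
Lemma oppb0 : - (0 : B) = 0. Proof. exact: (@invg1 A). Qed.
Lemma baddI a : injective (badd a). Proof. exact: (@mulgI A). Qed.
Lemma baddIr a : injective (fun x : B => x + a). Proof. exact: (@mulIg A). Qed.
Lemma mulb1 a : a * 1 = a. Proof. exact: (@mulg1 M). Qed.
Lemma mulbV a : a * a^-1 = 1. Proof. exact: (@mulgV M). Qed.
Lemma mulVKb a b : a * (a^-1 * b) = b. Proof. exact: (@mulVKg M). Qed.
Lemma mulKVb a b : a^-1 * (a * b) = b. Proof. exact: (@mulKg M). Qed.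
Lemma mulbK a b : b * a * a^-1 = b. Proof. exact: (@mulgK M). Qed.
Lemma invbK a : a^-1^-1 = a. Proof. exact: (@invgK M). Qed.

(** Expand a(0 + 0) and cancel; this makes the two identities coincide ([bone0]). *)
Lemma mulb0 a : a * 0 = a.
Proof.
have := bmulD a 0 0; rewrite badd0 -[LHS]badd0 => /baddIr /esym.
by move/(congr1 (fun x : B => x + a)); rewrite baddNKr badd0.
Qed.

Lemma bone0 : bone B = 0.
Proof. by rewrite -(mulb0 1) bmul1. Qed.

Lemma mulbE a b : a * b = a + blam a b.
Proof. by rewrite /blam baddKNl. Qed.

Lemma lamD a b c : blam a (b + c) = blam a b + blam a c.
Proof. by rewrite /blam bmulD !baddA. Qed.

Lemma lam0 a : blam a 0 = 0.
Proof. by rewrite /blam mulb0 baddN. Qed.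

Lemma lamN a b : blam a (- b) = - blam a b.
Proof. by apply: (@baddI (blam a b)); rewrite -lamD !baddrN lam0. Qed.

Lemma lam1 b : blam 1 b = b.
Proof. by rewrite /blam bmul1 bone0 oppb0 badd0. Qed.

Lemma lamM a b c : blam (a * b) c = blam a (blam b c).
Proof.
apply: (@baddI (a * b)); rewrite -mulbE -bmulA (mulbE b) bmulD.
by rewrite (mulbE a (blam b c)) -!baddA baddNKl.
Qed.

Lemma lamVK a b : blam a (blam a^-1 b) = b.
Proof. by rewrite -lamM mulbV lam1. Qed.

Lemma lamKV a b : blam a^-1 (blam a b) = b.
Proof. by rewrite -lamM bmulV lam1. Qed.

Lemma baddE a b : a + b = a * blam a^-1 b.
Proof. by rewrite mulbE lamVK. Qed.

Lemma invbE a : a^-1 = blam a^-1 (- a).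
Proof. by rewrite lamN /blam bmulV bone0 baddr0 oppbK. Qed.

(** This is why additive and multiplicative cosets of an ideal agree ([ideal_congr]). *)
Lemma lam_quot a b : - a + b = blam a (a^-1 * b).
Proof. by rewrite /blam mulVKb. Qed.

Lemma nmulE a n : nmul a n = @natexp A a n.
Proof. by elim: n => //= n ->; rewrite expgS. Qed.

Lemma zmulE a z : zmul a z = @zpow A a z.
Proof. by case: z => n; rewrite /zmul /zpow nmulE. Qed.

Lemma lam_nmul a b n : blam a (nmul b n) = nmul (blam a b) n.
Proof. by elim: n => [|n IHn] /=; rewrite ?lam0 // lamD IHn. Qed.

Lemma lam_zmul a b z : blam a (zmul b z) = zmul (blam a b) z.
Proof. by case: z => n; rewrite /zmul ?lamN lam_nmul. Qed.

Lemma lamX a b n : blam (@natexp M a n) b = iter n (blam a) b.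
Proof.
elim: n => [|n IHn] /=; first exact: lam1.
by rewrite expgS [blam _ _]lamM IHn.
Qed.

Definition left_ideal I := @subgroup A I /\ (forall b x, I x -> I (blam b x)).

(** Rests on x y = x + lambda_x(y) and on x^-1 = lambda_(x^-1)(-x). *)
Lemma left_ideal_mul I : left_ideal I -> @subgroup M I.
Proof.
move=> [sI lI]; split; first by rewrite /= [1%g]bone0; exact: subgroup1 sI.
split=> [x y Ix Iy|x Ix].
  by rewrite [(_ * _)%g]mulbE; apply: (subgroupM sI) => //; apply: lI.
by rewrite [(_^-1)%g]invbE; apply: lI; apply: (subgroupV sI).
Qed.

Lemma idealP I : is_ideal I <->
  [/\ @normal_subgroup A I, forall b x, I x -> I (blam b x)
    & forall b x, I x -> I (b * x * b^-1)].
Proof.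
split=> [[sI [_ [nI [mI lI]]]]|[[sI nI] lI mI]]; first by split.
by split=> //; split=> //; apply: left_ideal_mul.
Qed.

Section Ideal.
Variables (I : B -> Prop) (iI : is_ideal I).
Lemma ideal_add : @normal_subgroup A I. Proof. by case/idealP: iI. Qed.
Lemma ideal_addS : @subgroup A I. Proof. by case: ideal_add. Qed.
Lemma ideal_mul : @normal_subgroup M I. Proof. by case: iI => _ [? [_ []]]. Qed.
Lemma ideal_mulS : @subgroup M I. Proof. by case: ideal_mul. Qed.
Lemma ideal_lam b x : I x -> I (blam b x). Proof. by case/idealP: iI => _ + _; apply. Qed.
Lemma ideal_congr a b : congr_mod I a b <-> I (a^-1 * b).
Proof.
rewrite /congr_mod lam_quot; split=> [/(ideal_lam a^-1)|]; last exact: ideal_lam.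
by rewrite lamKV.
Qed.
Lemma ideal0 : I 0. Proof. by case: iI => [[]]. Qed.
Lemma idealD x y : I x -> I y -> I (x + y). Proof. by case: iI => [[_ [+ _]] _]; apply. Qed.
Lemma idealN x : I x -> I (- x). Proof. by case: iI => [[_ [_ +]] _]; apply. Qed.
Lemma idealM x y : I x -> I y -> I (x * y).
Proof. by case: iI => [_ [[_ [+ _]] _]]; apply. Qed.
Lemma ideal_addJ b x : I x -> I (b + x + - b).
Proof. by case: iI => [_ [_ [+ _]]]; apply. Qed.
Lemma ideal_mulJ b x : I x -> I (b * x * b^-1).
Proof. by case: iI => [_ [_ [_ [+ _]]]]; apply. Qed.
Lemma ideal_addJN b x : I x -> I (- b + x + b).
Proof. by move=> /(ideal_addJ (- b)); rewrite oppbK. Qed.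
Lemma ideal_mulJV b x : I x -> I (b^-1 * x * b).
Proof. by move=> /(ideal_mulJ b^-1); rewrite invbK. Qed.
Lemma ideal_nmul x n : I x -> I (nmul x n).
Proof. by rewrite nmulE; apply: (subgroupX ideal_addS). Qed.
Lemma ideal_zmul x z : I x -> I (zmul x z).
Proof. by rewrite zmulE; apply: (subgroup_zpow ideal_addS). Qed.
Lemma ideal_addl x y : I x -> I (x + y) <-> I y.
Proof. exact: (subgroupMl ideal_addS). Qed.
Lemma congr_refl x : congr_mod I x x.
Proof. by rewrite /congr_mod baddN; apply: ideal0. Qed.
Lemma congr_sym x y : congr_mod I x y -> congr_mod I y x.
Proof. by rewrite /congr_mod => /idealN; rewrite oppbD oppbK. Qed.
Lemma congr_trans x y z : congr_mod I x y -> congr_mod I y z -> congr_mod I x z.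
Proof. by move=> xy /(idealD xy); rewrite -baddA baddKNl. Qed.
Lemma congr_addl x y z : congr_mod I y z <-> congr_mod I (x + y) (x + z).
Proof. by rewrite /congr_mod oppbD -baddA baddNKl. Qed.
Lemma congr_addr x y z : congr_mod I x y -> congr_mod I (x + z) (y + z).
Proof. by rewrite /congr_mod oppbD => /(ideal_addJN z); rewrite -!baddA. Qed.
Lemma congr_lam x y z : congr_mod I y z -> congr_mod I (blam x y) (blam x z).
Proof. by rewrite /congr_mod -lamN -lamD => /ideal_lam; apply. Qed.

(** From x b = b (b^-1 x b) one gets lambda_x(b) = -x + b + lambda_b(b^-1 x b), whose outer summands
    lie in I. *)
Lemma ideal_lam_congr x b : I x -> congr_mod I (blam x b) b.
Proof.
move=> Ix; rewrite /congr_mod.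
have -> : blam x b = - x + (b + blam b (b^-1 * x * b)).
  by rewrite -mulbE -bmulA mulVKb.
rewrite 2!oppbD oppbK -!baddA; apply: idealD.
  by apply: idealN; apply: ideal_lam; apply: ideal_mulJV.
by rewrite baddA; apply: ideal_addJN.
Qed.

Lemma ideal_addC_congr x b : I x -> congr_mod I (x + b) (b + x).
Proof.
move=> Ix; rewrite /congr_mod oppbD baddA; apply: idealD => //.
by apply/ideal_addJN/idealN.
Qed.

End Ideal.

Lemma congr0 a b : congr_mod (triv (0 : B)) a b <-> a = b.
Proof.
rewrite /congr_mod /triv; split=> [|->]; last by rewrite baddN.
by move=> /(congr1 (badd a)); rewrite baddKNl baddr0.
Qed.

Lemma ideal_triv : is_ideal (triv (0 : B)).
Proof.
apply/idealP; split; first exact: (@normal_triv A).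
  by move=> b _ ->; apply: lam0.
by move=> b _ ->; rewrite -bone0 mulb1 mulbV.
Qed.

Lemma soc0P K : quot_in_soc K (triv (0 : B)) <->
  forall x, K x -> forall b, blam x b = b /\ x + b = b + x.
Proof.
by split=> sK x /sK + b => /(_ b) [xb bx]; split; apply/congr0.
Qed.

(** The additive transversal itself works, because both groups have the same cosets of K. *)
Lemma quot_card_mulP I K n : is_ideal K -> quot_card I K n ->
  exists f, @left_transversal M I K n f.
Proof.
move=> iK [f [fI injf surjf]]; exists f; split=> // [i j /(ideal_congr iK)|x Ix].
  exact: injf.
by have [i Ki] := surjf x Ix; exists i; apply/(ideal_congr iK).
Qed.

Section SocleSubgroup.
Variable K : B -> Prop.
Hypotheses (iK : is_ideal K) (sK : quot_in_soc K (triv (0 : B))).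

Lemma soc_lam x b : K x -> blam x b = b.
Proof. by move/soc0P: sK => /(_ x) + Kx => /(_ Kx b) []. Qed.

Lemma soc_addC x b : K x -> x + b = b + x.
Proof. by move/soc0P: sK => /(_ x) + Kx => /(_ Kx b) []. Qed.

Lemma soc_mul x b : K x -> x * b = x + b.
Proof. by move=> Kx; rewrite mulbE soc_lam. Qed.

(** b x = b + lambda_b(x) = lambda_b(x) + b = lambda_b(x) b, as lambda_b(x) is again in K. *)
Lemma soc_mulJ b x : K x -> b * x * b^-1 = blam b x.
Proof.
move=> Kx; have Kl := ideal_lam iK b Kx.
by rewrite (mulbE b x) -soc_addC // -soc_mul // mulbK.
Qed.

Lemma soc_expg x n : K x -> @natexp M x n = nmul x n.
Proof.
move=> Kx; elim: n => [|n IHn]; first exact: bone0.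
by rewrite expgS IHn; apply: soc_mul.
Qed.

(** Inside the socle, additive conjugation is trivial and multiplicative conjugation by b is
    lambda_b. *)
Lemma soc_sub_ideal N : @subgroup A N -> (forall x, N x -> K x) ->
  (forall b x, N x -> N (blam b x)) -> is_ideal N.
Proof.
move=> sN NK lN; apply/idealP; split=> //; last first.
  by move=> b x Nx; rewrite soc_mulJ //; [apply: lN | apply: NK].
split=> // b x Nx; rewrite (_ : (_ * _)%g = x) //.
by rewrite /= -[RHS](baddKr b) (soc_addC b (NK x Nx)).
Qed.
End SocleSubgroup.

(** * Transfer of factors when I is the sum of Q and K, which meet in 0 *)

Section Complement.
Variables I K Q : B -> Prop.
Hypotheses (iK : is_ideal K) (iQ : is_ideal Q).
Hypotheses (KI : forall x, K x -> I x) (QI : forall x, Q x -> I x).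
Hypothesis QK0 : forall x, Q x -> K x -> x = 0.
Hypothesis addQK : forall x, I x -> exists y k, [/\ Q y, K k & x = y + k].

Lemma complement_card n : quot_card I K n -> quot_card Q (triv (0 : B)) n.
Proof.
move=> [f [fI injf surjf]].
have [h hP] : exists h : 'I_n -> B, forall i, Q (h i) /\ congr_mod K (h i) (f i).
  apply: (@fin_all_exists _ _ (fun i y => Q y /\ congr_mod K y (f i))) => i.
  have [y [k [Qy Kk ->]]] := addQK (fI i).
  by exists y; split=> //; rewrite /congr_mod baddNKl.
exists h; split=> [i|i j|x Qx]; first by case: (hP i).
  move/congr0=> eh; apply: injf; apply: (congr_trans iK (y := h i)).
    by apply: congr_sym => //; case: (hP i).
  by rewrite eh; case: (hP j).
have [i Ki] := surjf x (QI Qx); exists i; have [Qh Kh] := hP i.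
apply: QK0; first exact: (idealD iQ (idealN iQ Qh) Qx).
exact: (congr_trans iK Kh Ki).
Qed.

Lemma complement_inf_cyclic :
  quot_inf_cyclic K (triv (0 : B)) -> quot_inf_cyclic I Q.
Proof.
move=> [g [Kg gen free]]; exists g; split; first exact: KI.
  move=> x /addQK[y [k [Qy Kk ->]]]; have [z /congr0 ez] := gen k Kk.
  exists z; rewrite ez /congr_mod baddA; exact: ideal_addJN.
by move=> z Qz; apply: free; apply: QK0 => //; apply: ideal_zmul.
Qed.

(** For x = y + k = k + y = k y one has lambda_x = lambda_y, and lambda_y is trivial modulo Q since
    y lies in Q. *)
Lemma complement_soc : quot_in_soc K (triv (0 : B)) -> quot_in_soc I Q.
Proof.
move=> sK x /addQK[y [k [Qy Kk ->]]] b; split.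
  rewrite -(soc_addC sK y Kk) -(soc_mul sK y Kk) lamM (soc_lam sK) //.
  exact: ideal_lam_congr.
rewrite -baddA (soc_addC sK b Kk) !baddA; apply: congr_addr => //.
exact: ideal_addC_congr.
Qed.
End Complement.

Lemma complementC I K Q : is_ideal Q -> is_ideal K ->
  (forall x, I x -> exists y k, [/\ Q y, K k & x = y + k]) ->
  forall x, I x -> exists k y, [/\ K k, Q y & x = k + y].
Proof.
move=> iQ iK addQK x /addQK[y [k [Qy Kk ->]]].
exists (y + k + - y), y; split=> //; last by rewrite baddNKr.
exact: ideal_addJ.
Qed.

End BraceTheory.

(** * Exchanging adjacent factors above the zero ideal *)

Section SwapAtBottom.
Local Open Scope brace_scope.
Variable B : brace.
Implicit Types (a b c x y k : B) (I J K Q : B -> Prop).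

Let A := addg B.
Let M := mulgp B.
Notation triv0 := (triv (0 : B)).

Lemma nmulJ b x n : nmul (b + x + - b) n = b + nmul x n + - b.
Proof. by rewrite !nmulE; apply: (@conj_expg A). Qed.

(* The complement is {x | q x = 0} = {x | x^q = 1}: the additive description shows it is
   invariant under lambda, the multiplicative one that it is normal in (B, .). *)
Lemma prime_index_complement I K q t : prime q ->
  is_ideal I -> is_ideal K -> (forall x, K x -> I x) -> quot_card I K q ->
  @centralizes A I I -> @centralizes M I I ->
  (forall k, K k -> nmul k q = 0 -> k = 0) ->
  (forall k, K k -> @natexp M k q = 1 -> k = 0) ->
  I t -> ~ K t -> nmul t q = 0 ->
  exists Q, [/\ is_ideal Q, forall x, Q x -> I x, forall x, Q x -> K x -> x = 0
    & forall x, I x -> exists y k, [/\ Q y, K k & x = y + k]].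
Proof.
move=> q_pr iI iK KI card_q cA cM torA torM It nKt qt.
pose Q x := I x /\ nmul x q = 0.
have QK0 x : Q x -> K x -> x = 0 by move=> [_ qx] Kx; apply: torA.
have sQ : @subgroup A Q.
  split; first by split; [apply: (ideal0 iI) | rewrite nmulE; exact: (@expg1n A q)].
  split=> [x y [Ix qx] [Iy qy]|x [Ix qx]].
    split; first exact: (idealD iI).
    rewrite nmulE expgMn; last exact: cA.
    by rewrite -!nmulE qx qy; apply: badd0.
  split; first exact: (idealN iI).
  by rewrite nmulE expVgn -nmulE qx; apply: oppb0.
have lQ b x : Q x -> Q (blam b x).
  by move=> [Ix qx]; split; [apply: ideal_lam | rewrite -lam_nmul qx lam0].
(* t lies in Q and generates I modulo K, so y can be taken to be a multiple of t. *)
have addQK x : I x -> exists y k, [/\ Q y, K k & x = y + k].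
  move=> Ix; have [f tf] := card_q.
  have [_ /(_ x Ix) [z Kz]] :=
    prime_transversal_cyclic (G := A) q_pr (ideal_addS iI) (ideal_add iK) tf It nKt.
  exists (@zpow A t z), (- (@zpow A t z) + x); split=> //; last by rewrite baddKNl.
  by apply: (subgroup_zpow sQ).
(* If y is in Q, then y^q lies in Q and in K, so it is 0 = 1. Conversely write x = y k'
   multiplicatively, with y in Q and k' in K; x^q = y^q = 1 gives k'^q = 1, so k' = 0. *)
have QM x : Q x <-> I x /\ @natexp M x q = 1.
  have [f tf] := quot_card_mulP iK card_q.
  have expM y : Q y -> @natexp M y q = 1.
    move=> Qy; have Qq := subgroupX (left_ideal_mul (conj sQ lQ)) q Qy.
    rewrite bone0; apply: (QK0 _ Qq).
    by have := transversal_exponent (G := M) (ideal_mulS iI) (ideal_mul iK) tf (proj1 Qy).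
  split=> [Qx|[Ix xq]]; first by split; [case: Qx | apply: expM].
  have [y [k [Qy Kk ex]]] := addQK x Ix.
  have ex' : x = y * blam y^-1 k by rewrite -baddE.
  have Kk' := ideal_lam iK y^-1 Kk.
  rewrite ex' (_ : blam y^-1 k = 0) ?mulb0 //; apply: (torM _ Kk').
  have : @natexp M (y * blam y^-1 k)%br q = @natexp M y q * @natexp M (blam y^-1 k)%br q.
    exact: (@expgMn M _ _ _ (cM _ _ (proj1 Qy) (KI _ Kk'))).
  by rewrite (expM _ Qy) bmul1 -ex' xq => <-.
exists Q; split=> //; last by move=> x [].
apply/idealP; split=> //.
  split=> // b x [Ix qx]; split; first exact: (ideal_addJ iI b).
  by apply: etrans (nmulJ b x q) _; rewrite qx baddr0 baddrN.
move=> b x /QM[Ix xq]; apply/QM; split; first exact: ideal_mulJ.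
by rewrite [natexp _ _]conj_expg xq mulg1 mulgV.
Qed.


Lemma complement_card_quot I K Q n : is_ideal Q -> is_ideal K ->
  (forall x, K x -> I x) -> (forall x, Q x -> K x -> x = 0) ->
  (forall x, I x -> exists y k, [/\ Q y, K k & x = y + k]) ->
  quot_card K triv0 n -> quot_card I Q n.
Proof.
move=> iQ iK KI QK0 addQK [f [Kf injf surjf]]; exists f; split=> [i|i j Qij|x Ix].
- exact: KI.
- by apply/injf/QK0 => //; apply: (idealD iK) => //; apply: (idealN iK).
have [k [y [Kk Qy ->]]] := complementC iQ iK addQK Ix.
have [i /congr0 <-] := surjf k Kk; exists i.
by rewrite /congr_mod baddNKl.
Qed.

Lemma quot_card_proper I K q : prime q -> is_ideal K -> quot_card I K q ->
  exists2 x, I x & ~ K x.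
Proof.
move=> q_pr iK [f tf].
exact: (prime_transversal_proper (G := A) q_pr (ideal_addS iK) tf).
Qed.

Lemma quot_card_exponent I K q x : is_ideal I -> is_ideal K -> quot_card I K q ->
  I x -> K (nmul x q).
Proof.
move=> iI iK [f tf] Ix; rewrite nmulE.
exact: (transversal_exponent (G := A) (ideal_addS iI) (ideal_add iK) tf).
Qed.

Lemma quot_card_mul_exponent I K q x : is_ideal I -> is_ideal K -> quot_card I K q ->
  I x -> K (@natexp M x q).
Proof.
move=> iI iK /(quot_card_mulP iK) [f tf] Ix.
exact: (transversal_exponent (G := M) (ideal_mulS iI) (ideal_mul iK) tf).
Qed.

Lemma swap_primes_bottom I K p q : prime p -> prime q -> p < q ->
  is_ideal I -> is_ideal K -> (forall x, K x -> I x) ->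
  quot_card K triv0 p -> quot_card I K q ->
  exists Q, [/\ is_ideal Q, forall x, Q x -> I x, quot_card Q triv0 q & quot_card I Q p].
Proof.
move=> p_pr q_pr ltpq iI iK KI card_p card_q; have iT := ideal_triv B.
have [f tf] := card_p; have [h th] := card_q.
have [f' tf'] := quot_card_mulP iT card_p; have [h' th'] := quot_card_mulP iK card_q.
rewrite /triv -bone0 in tf'.
have [x Ix nKx] := quot_card_proper q_pr iK card_q.
(* The torsion element is t = p x: q t = p (q x) = 0 because q x is in K, of exponent p. It is
   outside K, since p x and q x in K would put x in K. *)
have [||k Kk|k Kk||||Q [iQ QI QK0 addQK]] :=
  @prime_index_complement I K q (nmul x p) q_pr iI iK KI card_q.
- exact: (prime_by_larger_prime_abelian (G := A) p_pr q_pr ltpq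
    (ideal_addS iI) (ideal_add iK) KI tf th).
- exact: (prime_by_larger_prime_abelian (G := M) p_pr q_pr ltpq
    (ideal_mulS iI) (ideal_mul iK) KI tf' th').
- rewrite nmulE; exact: (prime_order_torsion (G := A) p_pr q_pr ltpq (ideal_addS iK) tf).
- rewrite -bone0; exact: (prime_order_torsion (G := M) p_pr q_pr ltpq (ideal_mulS iK) tf').
- exact: ideal_nmul.
- move=> Kpx; apply: nKx; rewrite nmulE in Kpx.
  apply: (@subgroup_coprimeX A K (ideal_addS iK) x p q) => //.
    by rewrite coprime_sym prime_coprime // gtnNdvd // prime_gt0.
  by rewrite -nmulE; apply: quot_card_exponent card_q Ix.
- rewrite !nmulE -expgnA mulnC expgnA -!nmulE.
  exact: (quot_card_exponent iK iT card_p (quot_card_exponent iI iK card_q Ix)).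
exists Q; split=> //; first exact: complement_card card_q.
exact: complement_card_quot addQK card_p.
Qed.

End SwapAtBottom.


(** * Exchanges that involve an infinite cyclic factor *)

Section SwapInfiniteAtBottom.
Local Open Scope brace_scope.
Variable B : brace.
Implicit Types (a b c x y k : B) (I J K Q : B -> Prop).

Let A := addg B.
Let M := mulgp B.
Notation triv0 := (triv (0 : B)).

Definition inf_soc I J := quot_inf_cyclic I J /\ quot_in_soc I J.

Lemma inf_cyclic0P K : quot_inf_cyclic K triv0 <->
  exists g, [/\ K g, forall k, K k -> exists z, @zpow A g z = k
                & forall z, @zpow A g z = 0 -> z = 0%R].
Proof.
split=> -[g [Kg gen free]]; exists g; split=> // [k /gen[z e]|z e].
- by exists z; rewrite -zmulE; apply/congr0.
- by apply: free; rewrite /triv zmulE.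
- by exists z; apply/congr0; rewrite zmulE.
- by apply: free; rewrite -zmulE.
Qed.

Lemma inf_cyclic_torsion K k n : (0 < n)%N -> quot_inf_cyclic K triv0 ->
  K k -> nmul k n = 0 -> k = 0.
Proof.
move=> n_gt0 /inf_cyclic0P[g [Kg gen free]] /gen[z <-].
rewrite nmulE -zpowMn => /free ez; rewrite (_ : z = 0%R) //.
by move/eqP: ez; rewrite mulf_eq0 => /orP[/eqP //|]; lia.
Qed.

(** On K the q-th iterate of lambda_x is lambda of x^q, so the odd-period lemma applies to a
    generator. *)
Lemma inf_cyclic_lam_fixed K x q : odd q -> is_ideal K -> quot_inf_cyclic K triv0 ->
  (forall k, K k -> blam (@natexp M x q) k = k) -> forall k, K k -> blam x k = k.
Proof.
move=> oq iK /inf_cyclic0P[g [Kg gen free]] fixq.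
have lamz z : blam x (@zpow A g z) = @zpow A (blam x g) z.
  by rewrite -!zmulE lam_zmul.
have [a ea] := gen _ (ideal_lam iK x Kg).
have fixg : blam x g = g.
  apply: (infinite_cyclic_odd_period (G := A) free lamz (esym ea) oq).
  by rewrite -lamX fixq.
by move=> _ /gen[z <-]; rewrite lamz fixg.
Qed.

Lemma soc_centralizes I K : quot_in_soc K triv0 -> @centralizes A K I.
Proof. by move=> sK k x Kk _; apply: (soc_addC sK). Qed.

(** The first alternative covers an I without q-torsion, as when K = qZ in I = Z: no complement
    exists, and the factor of order q is absorbed. *)
Lemma swap_inf_soc_bottom I K q : prime q -> q != 2 ->
  is_ideal I -> is_ideal K -> (forall x, K x -> I x) ->
  inf_soc K triv0 -> quot_card I K q ->
  inf_soc I triv0 \/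
  exists Q, [/\ is_ideal Q, forall x, Q x -> I x, quot_card Q triv0 q & inf_soc I Q].
Proof.
move=> q_pr q_neq2 iI iK KI [cK sK] card_q.
have oq : odd q by case: (even_prime q_pr) => // e; rewrite e in q_neq2.
have q_gt0 := prime_gt0 q_pr.
have [f tf] := card_q; have [h th] := quot_card_mulP iK card_q.
have fixq x : I x -> forall b, blam (@natexp M x q) b = b.
  by move=> Ix b; apply: (soc_lam sK); apply: quot_card_mul_exponent card_q Ix.
have cA : @centralizes A I I.
  exact: (prime_index_abelian (G := A) q_pr (ideal_addS iI) (ideal_add iK) KI tf
    (soc_centralizes sK)).
(* k x = k + x = x + k = x + lambda_x(k) = x k, where lambda_x fixes k because its q-th power is
   trivial. *)
have cKM : @centralizes M K I.
  move=> k x Kk Ix; apply: etrans (soc_mul sK x Kk) _.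
  rewrite (soc_addC sK) // -[in LHS](inf_cyclic_lam_fixed (x := x) oq iK cK _ Kk) -?mulbE //.
  by move=> ? _; apply: fixq.
have cM : @centralizes M I I.
  exact: (prime_index_abelian (G := M) q_pr (ideal_mulS iI) (ideal_mul iK) KI th cKM).
have [[t [It nKt qt]]|not] := pselect (exists t, [/\ I t, ~ K t & nmul t q = 0]).
  right; have [||Q [iQ QI QK0 addQK]] :=
      prime_index_complement q_pr iI iK KI card_q cA cM _ _ It nKt qt.
  - by move=> k; apply: inf_cyclic_torsion.
  - by move=> k Kk; rewrite (soc_expg sK) // bone0; apply: (inf_cyclic_torsion q_gt0 cK Kk).
  exists Q; split=> //; first exact: complement_card card_q.
  by split; [apply: (@complement_inf_cyclic _ I K Q) | apply: (@complement_soc _ I K Q)].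
left.
have torI x : I x -> nmul x q = 0 -> x = 0.
  move=> Ix qx; have [Kx|nKx] := pselect (K x).
    exact: (inf_cyclic_torsion q_gt0 cK Kx qx).
  by case: not; exists x.
have [g [Kg gen free]] := (inf_cyclic0P K).1 cK.
have [x Ix nKx] := quot_card_proper q_pr iK card_q.
have [||y [Iy yq geny]] := prime_index_infinite_cyclic (G := A) q_pr (ideal_addS iI)
   (ideal_addS iK) KI cA _ Kg gen _ Ix nKx.
- by move=> z Iz; rewrite -nmulE; apply: quot_card_exponent card_q Iz.
- by move=> z Iz; rewrite -nmulE; apply: torI.
have cI : quot_inf_cyclic I triv0.
  apply/inf_cyclic0P; exists y; split=> // z ez; apply: free.
  by rewrite -yq -zpow_expg ez; apply: (@expg1n A q).
split=> //; apply/soc0P=> z Iz b.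
have Iconj : I (- b + z + b) by apply: ideal_addJN.
split; last first.
  (* q z lies in K and is central, so z and -b + z + b have the same q-fold multiple; I is abelian
     without q-torsion. *)
  have -> : z + b = b + (- b + z + b) by rewrite -baddA baddKNl.
  congr (_ + _); apply/(congr0 _ _).
  apply: torI; first by apply: (idealD iI) => //; apply: (idealN iI).
  rewrite nmulE [natexp _ _](@expgMn A); last by apply: cA => //; apply: (idealN iI).
  have := nmulJ (- b) z q; rewrite oppbK => eJ.
  have Kqz : K (nmul z q) by apply: quot_card_exponent card_q Iz.
  rewrite expVgn -!nmulE eJ -baddA (soc_addC sK b Kqz) baddNKl.
  exact: baddN.
(* Now I itself is infinite cyclic, so the odd-period argument applies to it. With lambda_z(b) = b +
   c and c in I fixed, q iterations give b = b + q c, hence c = 0. *)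
have lamI c : I c -> blam z c = c.
  by apply: (inf_cyclic_lam_fixed oq iI cI) => k _; apply: fixq.
have [c Ic ec] : exists2 c, I c & blam z b = b + c.
  exists (- b + blam z b); last by rewrite baddKNl.
  by apply: (congr_sym iI); apply: (ideal_lam_congr iI).
have iterb n : iter n (blam z) b = b + nmul c n.
  elim: n => [|n IHn] /=; first by rewrite baddr0.
  by rewrite IHn lamD lam_nmul (lamI c Ic) ec -baddA.
have := fixq z Iz b; rewrite lamX iterb => e.
have := congr1 (badd (- b)) e; rewrite baddNKl baddN => /(torI c Ic) c0.
by rewrite ec c0 baddr0.
Qed.


Lemma quot_card2I I J c : is_ideal J -> I 0 -> I c -> ~ J c ->
  (forall x, I x -> J x \/ J (- c + x)) -> quot_card I J 2.
Proof.
move=> iJ I0 Ic nJc cover.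
exists (fun i : 'I_2 => if i == ord0 then 0 else c); split.
- by move=> i; case: ifP.
- rewrite /congr_mod => i j.
  have [-> | i0] := eqVneq i ord0; have [-> | j0] := eqVneq j ord0 => //.
  + by rewrite oppb0 badd0.
  + by rewrite baddr0 => /(idealN iJ); rewrite oppbK.
  + by case: i i0 => [[|[]] ?] //; case: j j0 => [[|[]] ?] // _ _ _; apply: val_inj.
move=> x /cover[Jx|Jcx]; last by exists ord_max.
by exists ord0; rewrite /congr_mod /= oppb0 badd0.
Qed.

Lemma quot_card2_bottom K : is_ideal K -> quot_card K triv0 2 ->
  exists c, [/\ K c, c <> 0 & forall x, K x -> x = 0 \/ x = c].
Proof.
move=> iK cardK; have iT := ideal_triv B.
have [c Kc nc] := quot_card_proper (q := 2) isT iT cardK.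
have [f tf] := cardK; exists c; split=> // x Kx.
have [_ /(_ x Kx)[a]] := prime_transversal_cyclic (G := A) (q := 2) isT
  (ideal_addS iK) (ideal_add iT) tf Kc nc.
move/(congr0 _ _) => <-.
have c2 : @natexp A c 2 = 0 by rewrite -nmulE; apply: (quot_card_exponent iK iT cardK).
have [m [e ->]] : exists (m : int) (e : bool), a = (m * 2%:Z + e%:Z)%R.
  by exists (a %/ 2)%Z, (a %% 2 == 1)%Z; have := divz_eq a 2; lia.
rewrite zpowD zpowMn zpow_expg c2.
have -> : @zpow A 0 m = 0 by case: m => n /=; rewrite expg1n ?invg1.
by case: e; [right|left]; rewrite mul1g.
Qed.

(** The ideal is 2I, characteristic in (I,+) and inside the socle. Two uses of this lead to 4I, each
    leaving a factor of order 2 above. *)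
Lemma inf_soc_double_bottom I : is_ideal I -> inf_soc I triv0 ->
  exists I', [/\ is_ideal I', forall x, I' x -> exists2 y, I y & x = y + y,
    forall y, I y -> I' (y + y), inf_soc I' triv0 & quot_card I I' 2].
Proof.
move=> iI [cI sI]; pose I' x := exists2 y, I y & x = y + y.
have I'I x : I' x -> I x by move=> [y Iy ->]; apply: idealD.
have sI' : @subgroup A I'.
  split; first by exists 0; [apply: ideal0 | rewrite badd0].
  split=> [_ _ [x Ix ->] [y Iy ->]|_ [x Ix ->]].
    exists (x + y); first exact: idealD.
    rewrite -[LHS]/(x + x + (y + y)) -!baddA; congr (_ + _).
    by rewrite !baddA (soc_addC sI y Ix).
  exists (- x); first exact: idealN.
  by rewrite -oppbD.
have iI' : is_ideal I'.
  apply: (soc_sub_ideal iI sI sI' I'I) => b _ [x Ix ->].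
  by exists (blam b x); [apply: ideal_lam | rewrite lamD].
have [g [Ig gen free]] := (inf_cyclic0P I).1 cI.
have gg z : @zpow A (g + g) z = @zpow A g (2%:Z * z)%R.
  by rewrite zpowM.
exists I'; split=> //; first by move=> y Iy; exists y.
- split; last by move=> x /I'I; apply: sI.
  apply/inf_cyclic0P; exists (g + g); split=> [|_ [x /gen[z <-] ->]|z].
  + by exists g.
  + by exists z; rewrite gg mulrC zpowMn.
  + by rewrite gg => /free; lia.
- apply: (quot_card2I iI' (ideal0 iI) Ig) => [[y /gen[z <-] e]|x /gen[z <-]].
    suff : @zpow A g (1 - 2%:Z * z)%R = 0 by move/free; lia.
    rewrite zpowD zpowN mulrC zpowMn [X in (X * _)%g](_ : _ = g) //.
    by rewrite {1}e; apply: (@mulgV A).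
  have [m [d ->]] : exists (m : int) (d : bool), z = (d%:Z + m * 2%:Z)%R.
    by exists (z %/ 2)%Z, (z %% 2 == 1)%Z; have := divz_eq z 2; lia.
  rewrite zpowD zpowMn; have Im : I (@zpow A g m) by apply: (subgroup_zpow (ideal_addS iI)).
  case: d; [right|left]; exists (@zpow A g m) => //.
    exact: (@mulKg A g).
  exact: badd0.
Qed.

(* For x in I one has lambda_x(x) = x + k with k in K, so x^2 = 2x + k need not be 2x, but
   lambda_(x^2) = id and x^4 = 4x: hence the factor 4. *)
Lemma swap_two_inf_soc_bottom I K I4 :
  is_ideal I -> is_ideal K -> is_ideal I4 ->
  (forall x, K x -> I4 x) -> (forall x, I4 x -> I x) ->
  quot_card K triv0 2 -> inf_soc I K ->
  (forall y, I y -> I4 (nmul y 4)) ->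
  (forall x, I4 x -> exists2 y, I y & congr_mod K (nmul y 4) x) ->
  exists N, [/\ is_ideal N, forall x, N x -> I4 x, inf_soc N triv0 & quot_card I4 N 2].
Proof.
move=> iI iK iI4 KI4 I4I card_K [[g [Ig gen free]] sIK] quadI4 I4quad.
have KI x : K x -> I x by move/KI4/I4I.
have [c [Kc c_neq0 Kcover]] := quot_card2_bottom iK card_K.
have Kuniq k k' : K k -> K k' -> k <> 0 -> k' <> 0 -> k = k'.
  by move=> /Kcover[]-> // /Kcover[]->.
(* K has a single nonzero element, so it is fixed by every lambda_b and by every additive
   conjugation. *)
have Kfix (phi : B -> B) k : (forall x, K x -> K (phi x)) ->
    injective phi -> phi 0 = 0 -> K k -> phi k = k.
  move=> Kphi inj_phi phi0 Kk; have [->//|k_neq0] := pselect (k = 0).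
  by apply: Kuniq => //; [apply: Kphi | move=> e; apply: k_neq0; apply: inj_phi; rewrite e phi0].
have lamK b k : K k -> blam b k = k.
  apply: Kfix; [by move=> x; apply: ideal_lam | exact: can_inj (lamKV b) | exact: lam0].
have KC k b : K k -> k + b = b + k.
  move=> Kk; rewrite -{1}(Kfix (fun x => b + x + - b) k) ?baddNKr //.
  - by move=> x; apply: ideal_addJ.
  - by move=> x y /baddIr /baddI.
  - by rewrite baddr0 baddrN.
have kk k : K k -> k + k = 0.
  by move=> Kk; have := quot_card_exponent iK (ideal_triv B) card_K Kk; rewrite /= baddr0.
have cA : @centralizes A I I.
  apply: (cyclic_mod_abelian (G := A) (K := K) (g := g) (ideal_addS iI)) => //.
    split=> // x Ix; have [z Kz] := gen x Ix.
    by exists z; rewrite -zmulE.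
  by move=> k x Kk _; apply: KC.
have lam_mod x b : I x -> exists2 k, K k & blam x b = b + k.
  move=> Ix; exists (- b + blam x b); last by rewrite baddKNl.
  exact: (congr_sym iK (sIK x Ix b).1).
have lam2 x b : I x -> blam (x * x) b = b.
  move=> Ix; have [k Kk ek] := lam_mod x b Ix.
  by rewrite lamM ek lamD (lamK x k Kk) ek -baddA (kk k Kk) baddr0.
have quadE x : I x -> nmul x 4 = x * x * (x * x).
  move=> Ix; have [k Kk ek] := lam_mod x x Ix.
  rewrite (mulbE (x * x)) lam2 // (mulbE x) ek /= baddr0.
  rewrite -!baddA; congr (_ + (_ + _)).
  by rewrite (KC k) // -!baddA (kk k Kk) baddr0.
(* 4y depends only on y modulo K, because k is central and 4k = 0. *)
have nmul4D y k : K k -> nmul (y + k) 4 = nmul y 4.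
  move=> Kk; rewrite nmulE [LHS](@expgMn A); last exact: (esym (KC k y Kk)).
  rewrite -!nmulE (_ : nmul k 4 = 0); first exact: baddr0.
  by rewrite /= baddr0 (kk k Kk) baddr0 (kk k Kk).
have quad_gen y : I y -> exists z, nmul y 4 = @zpow A (nmul g 4) z.
  move=> Iy; have [z Kz] := gen y Iy; exists z.
  rewrite -(baddKNl (zmul g z) y) nmul4D // !nmulE -zpow_expg zmulE; by [].
pose N x := exists2 y, I y & x = nmul y 4.
have NI4 x : N x -> I4 x by move=> [y Iy ->]; apply: quadI4.
have lamN_id x b : N x -> blam x b = b.
  by move=> [y Iy ->]; rewrite quadE // lamM !lam2.
(* I/K is central in B/K, so b + y - b = y + k with k in K, and multiplying by 4 removes k. *)
have NC x b : N x -> x + b = b + x.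
  move=> [y Iy ->].
  have [k Kk ek] : exists2 k, K k & b + y + - b = y + k.
    exists (- y + (b + y + - b)); last by rewrite baddKNl.
    have := ideal_addJ iK b (sIK y Iy b).2.
    by rewrite oppbD !baddA baddrN badd0.
  have := nmulJ b y 4; rewrite ek.
  by rewrite nmul4D // => {1}->; rewrite baddNKr.
have iN : is_ideal N.
  apply/idealP; split.
  - split; last first.
      move=> b x Nx; suff : N (b + x + - b) by [].
      by rewrite -(NC x b Nx) baddKr.
    split; first by exists 0; [apply: ideal0 | rewrite /= !badd0].
    split=> [_ _ [x Ix ->] [y Iy ->]|_ [x Ix ->]].
      exists (x + y); first exact: idealD.
      by rewrite !nmulE [RHS](@expgMn A) //; apply: cA.
    exists (- x); first exact: idealN.
    rewrite !nmulE; exact: (esym (@expVgn A x 4)).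
  - move=> b _ [x Ix ->]; exists (blam b x); first exact: ideal_lam.
    exact: lam_nmul.
  (* By [quadE] 4x is the fourth multiplicative power of x, and powers commute with conjugation. *)
  - move=> b _ [x Ix ->]; exists (b * x * b^-1); first exact: ideal_mulJ.
    rewrite !quadE //; last exact: ideal_mulJ.
    by rewrite -!bmulA !mulKVb.
have quad_free z : K (@zpow A (nmul g 4) z) -> z = 0%R.
  rewrite nmulE -zpow_expg -zpowMn -zmulE => Kz.
  by have := free (z * 4%:Z)%R Kz; lia.
have NK0 x : N x -> K x -> x = 0.
  by move=> [y Iy ->]; have [z ->] := quad_gen y Iy; move/quad_free => ->.
exists N; split=> //.
- split; last by move=> x Nx b; split; apply/congr0; [apply: lamN_id | apply: NC].
  apply/inf_cyclic0P; exists (nmul g 4); split.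
  + by exists g.
  + by move=> _ [y Iy ->]; have [z ->] := quad_gen y Iy; exists z.
  + by move=> z e; apply: quad_free; rewrite e; apply: ideal0.
(* An element of I4 differs from some 4y by an element of K, that is by 0 or c; so 0 and c represent
   I4 modulo N. *)
- apply: (quot_card2I iN (ideal0 iI4) (KI4 _ Kc)) => [/NK0/(_ Kc) //|x I4x].
  have [y Iy Kyx] := I4quad x I4x; have Ny : N (nmul y 4) by exists y.
  have [k_0|k_c] := Kcover _ Kyx; [left|right].
    by move/(congr0 (nmul y 4) x): k_0 => <-.
  by rewrite -(baddKNl (nmul y 4) x) k_c -(KC c) // baddNKl.
Qed.

End SwapInfiniteAtBottom.


(** * Quotient braces *)

Section BraceMorphism.
Local Open Scope brace_scope.
Variables (B C : brace) (pi : B -> C).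
Hypotheses (piD : forall x y, pi (x + y) = pi x + pi y)
  (piM : forall x y, pi (x * y) = pi x * pi y)
  (pi_surj : forall c, exists x, pi x = c).
Implicit Types (I K : B -> Prop) (P R : C -> Prop).

Lemma morph0 : pi 0 = 0.
Proof. by apply: (@baddI C (pi 0)); rewrite -piD !baddr0. Qed.
Lemma morphN x : pi (- x) = - pi x.
Proof. by apply: (@baddI C (pi x)); rewrite -piD !baddrN morph0. Qed.
Lemma morph1 : pi 1 = 1. Proof. by rewrite !bone0 morph0. Qed.
Lemma morphV x : pi x^-1 = (pi x)^-1.
Proof. by rewrite -[LHS]bmul1 -(bmulV (pi x)) -bmulA -piM mulbV morph1 mulb1. Qed.
Lemma morph_lam x y : pi (blam x y) = blam (pi x) (pi y).
Proof. by rewrite /blam piD morphN piM. Qed.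
Lemma morph_nmul x n : pi (nmul x n) = nmul (pi x) n.
Proof. by elim: n => [|n IHn] /=; rewrite ?morph0 // piD IHn. Qed.
Lemma morph_zmul x z : pi (zmul x z) = zmul (pi x) z.
Proof. by case: z => n; rewrite /zmul ?morphN morph_nmul. Qed.

(** The form in which the correspondence theorem is used: ideals and factors then match in both
    directions. *)
Definition preimage I P := forall x, P (pi x) <-> I x.

Lemma preimage_ideal I P : preimage I P -> is_ideal I <-> is_ideal P.
Proof.
move=> IP; split=> [iI|iP].
  have lift c : P c -> exists2 x, I x & pi x = c.
    by have [x <-] := pi_surj c => /IP Ix; exists x.
  split; [|split; [|split; [|split]]].
  - split; first by rewrite -morph0; apply/IP; exact: (ideal0 iI).
    split=> [_ _ /lift[x Ix <-] /lift[y Iy <-]|_ /lift[x Ix <-]].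
      by rewrite -piD; apply/IP; exact: (idealD iI Ix Iy).
    by rewrite -morphN; apply/IP; exact: (idealN iI Ix).
  - split; first by rewrite -morph1; apply/IP; rewrite bone0; exact: (ideal0 iI).
    split=> [_ _ /lift[x Ix <-] /lift[y Iy <-]|_ /lift[x Ix <-]].
      by rewrite -piM; apply/IP; exact: (idealM iI Ix Iy).
    by rewrite -morphV; apply/IP; case: iI => [_ [[_ [_ +]] _]]; apply.
  - move=> c _ /lift[x Ix <-]; have [b <-] := pi_surj c.
    by rewrite -morphN -!piD; apply/IP; exact: (ideal_addJ iI b Ix).
  - move=> c _ /lift[x Ix <-]; have [b <-] := pi_surj c.
    by rewrite -morphV -!piM; apply/IP; exact: (ideal_mulJ iI b Ix).
  - move=> c _ /lift[x Ix <-]; have [b <-] := pi_surj c.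
    by rewrite -morph_lam; apply/IP; exact: (ideal_lam iI b Ix).
split; [|split; [|split; [|split]]].
- split; first by apply/IP; rewrite morph0; apply: ideal0.
  split=> [x y /IP Px /IP Py|x /IP Px]; apply/IP.
    by rewrite piD; apply: idealD.
  by rewrite morphN; apply: idealN.
- split; first by apply/IP; rewrite bone0 morph0; apply: ideal0.
  split=> [x y /IP Px /IP Py|x /IP Px]; apply/IP.
    by rewrite piM; apply: idealM.
  by rewrite morphV; case: iP => [_ [[_ [_ +]] _]]; apply.
- by move=> b x /IP Px; apply/IP; rewrite !piD morphN; apply: ideal_addJ.
- by move=> b x /IP Px; apply/IP; rewrite !piM morphV; apply: ideal_mulJ.
- by move=> b x /IP Px; apply/IP; rewrite morph_lam; apply: ideal_lam.
Qed.

Lemma preimage_congr K R x y : preimage K R ->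
  congr_mod R (pi x) (pi y) <-> congr_mod K x y.
Proof. by move=> KR; rewrite /congr_mod -morphN -piD; apply: KR. Qed.

Lemma preimage_card I P K R n : preimage I P -> preimage K R ->
  quot_card I K n <-> quot_card P R n.
Proof.
move=> IP KR; split=> [[f [fI injf surjf]]|[h [hP injh surjh]]].
  exists (fun i => pi (f i)); split=> [i|i j|c].
  - exact/IP.
  - by move/(preimage_congr _ _ KR)/injf.
  - have [x <-] := pi_surj c => /IP/surjf[i Ki]; exists i.
    exact/(preimage_congr _ _ KR).
have [f ef] : exists f : 'I_n -> B, forall i, pi (f i) = h i.
  by apply: (@fin_all_exists _ _ (fun i x => pi x = h i)) => i.
exists f; split=> [i|i j|x].
- by apply/IP; rewrite ef.
- by move/(preimage_congr _ _ KR); rewrite !ef => /injh.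
- move/IP/surjh=> [i Ri]; exists i; apply/(preimage_congr _ _ KR).
  by rewrite ef.
Qed.

Lemma preimage_inf_soc I P K R : preimage I P -> preimage K R ->
  inf_soc I K <-> inf_soc P R.
Proof.
move=> IP KR; split=> -[[g [Ig gen free]] soc]; split.
- exists (pi g); split=> [|c|z]; first exact/IP.
    have [x <-] := pi_surj c => /IP/gen[z Kz]; exists z.
    by rewrite -morph_zmul; apply/(preimage_congr _ _ KR).
  by rewrite -morph_zmul => /KR/free.
- move=> c; have [x <-] := pi_surj c => /IP/soc sx d; have [b <-] := pi_surj d.
  by rewrite -morph_lam -!piD; have [? ?] := sx b; split; apply/(preimage_congr _ _ KR).
- have [x ex] := pi_surj g; rewrite -ex in Ig gen free; exists x; split=> [|y|z].
  + exact/IP.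
  + by move/IP/gen=> [z Rz]; exists z; apply/(preimage_congr _ _ KR); rewrite morph_zmul.
  + by move/KR; rewrite morph_zmul => /free.
- move=> x /IP/soc sx b; have [e1 e2] := sx (pi b).
  by split; apply/(preimage_congr _ _ KR); rewrite ?morph_lam ?piD.
Qed.

End BraceMorphism.

Section Quotient.
Local Open Scope brace_scope.
Variables (B : brace) (J : B -> Prop).
Hypothesis iJ : is_ideal J.

Lemma congrD a a' b b' : congr_mod J a a' -> congr_mod J b b' ->
  congr_mod J (a + b) (a' + b').
Proof.
move=> aa' bb'; apply: (congr_trans iJ (y := a + b')).
  by rewrite -congr_addl.
exact: congr_addr.
Qed.

Lemma congrM a a' b b' : congr_mod J a a' -> congr_mod J b b' ->
  congr_mod J (a * b) (a' * b').
Proof.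
move=> aa' bb'; apply: (congr_trans iJ (y := a * b')).
  by rewrite (mulbE a) (mulbE a b'); rewrite -congr_addl; exact: (congr_lam iJ).
apply/(ideal_congr iJ); move/(ideal_congr iJ): aa' => /(ideal_mulJV iJ b').
rewrite (_ : (a * b')^-1 = b'^-1 * a^-1) ?bmulA //.
exact: (@invgM (mulgp B)).
Qed.

Lemma congrN a a' : congr_mod J a a' -> congr_mod J (- a) (- a').
Proof.
move=> /(congr_sym iJ) /(ideal_addJ iJ a').
by rewrite /congr_mod oppbK baddKNl.
Qed.

Lemma congrV a a' : congr_mod J a a' -> congr_mod J a^-1 a'^-1.
Proof.
move=> /(congr_sym iJ) /(ideal_congr iJ) /(ideal_mulJ iJ a').
by rewrite mulVKb => ?; apply/(ideal_congr iJ); rewrite invbK.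
Qed.

(** Classes are predicates, so extensionality turns congruence into equality, and choice supplies
    the representatives that define the operations. *)
Definition quot_car := {P : B -> Prop | exists b, P = congr_mod J b}.
Definition quot_proj (b : B) : quot_car := exist _ (congr_mod J b) (ex_intro _ b erefl).
Definition quot_repr (u : quot_car) : B := projT1 (cid (projT2 u)).

Lemma quot_projP a b : quot_proj a = quot_proj b <-> congr_mod J a b.
Proof.
split=> [/(congr1 (@proj1_sig _ _)) /= e|ab].
  by have := congr_refl iJ b; rewrite -e.
apply: eq_exist; apply/predeqP => x; split; last exact: congr_trans.
by apply: congr_trans => //; apply: congr_sym.
Qed.

Lemma quot_reprK u : quot_proj (quot_repr u) = u.
Proof.
case: u => P eP; rewrite /quot_repr /=; case: cid => b /= eb.
exact: eq_exist.
Qed.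

Lemma congr_repr a : congr_mod J (quot_repr (quot_proj a)) a.
Proof. by apply/quot_projP; rewrite quot_reprK. Qed.

Let add u v := quot_proj (quot_repr u + quot_repr v).
Let mul u v := quot_proj (quot_repr u * quot_repr v).
Let opp u := quot_proj (- quot_repr u).
Let inv u := quot_proj (quot_repr u)^-1.

Let addE a b : add (quot_proj a) (quot_proj b) = quot_proj (a + b).
Proof. by apply/quot_projP/congrD; apply: congr_repr. Qed.
Let mulE a b : mul (quot_proj a) (quot_proj b) = quot_proj (a * b).
Proof. by apply/quot_projP/congrM; apply: congr_repr. Qed.
Let oppE a : opp (quot_proj a) = quot_proj (- a).
Proof. by apply/quot_projP/congrN; apply: congr_repr. Qed.
Let invE a : inv (quot_proj a) = quot_proj a^-1.
Proof. by apply/quot_projP/congrV; apply: congr_repr. Qed.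

Lemma quotient_brace : exists (C : brace) (pi : B -> C),
  [/\ forall x y, pi (x + y) = pi x + pi y, forall x y, pi (x * y) = pi x * pi y,
      forall c, exists x, pi x = c & forall x y, pi x = pi y <-> congr_mod J x y].
Proof.
have projK u : exists a, u = quot_proj a by exists (quot_repr u); rewrite quot_reprK.
unshelve eexists (@Brace quot_car add opp (quot_proj 0) mul inv (quot_proj 1) _ _ _ _ _ _ _),
  quot_proj; last first.
  split=> [x y|x y|c|x y]; [exact/esym/addE | exact/esym/mulE | | exact: quot_projP].
  by exists (quot_repr c); apply: quot_reprK.
(* Every variable becomes the class of an element of B, so each axiom reduces to the same axiom in
   B. *)
all: repeat (let u := fresh "u" in move=> u; have [? ->] := projK u; clear u).
all: rewrite !(addE, mulE, oppE, invE); congr quot_proj.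
all: by [apply: baddA | apply: badd0 | apply: baddN | apply: bmulA
        | apply: bmul1 | apply: bmulV | apply: bmulD].
Qed.

Lemma quotient_idealP (I : B -> Prop) (C : brace) (pi : B -> C) :
  (forall x y, pi x = pi y <-> congr_mod J x y) -> is_ideal I ->
  (forall x, J x -> I x) -> preimage pi I (fun c => exists2 x, I x & pi x = c).
Proof.
move=> piE iI JI x; split=> [[y Iy /piE /JI Iyx]|Ix]; last by exists x.
exact: (ideal_addl iI x (idealN iI Iy)).1 Iyx.
Qed.

Lemma quotient_triv (C : brace) (pi : B -> C) :
  (forall x y, pi (x + y) = pi x + pi y) ->
  (forall x y, pi x = pi y <-> congr_mod J x y) -> preimage pi J (triv 0).
Proof.
move=> piD piE x; rewrite /triv -(morph0 piD); split.
  move/esym/piE; rewrite /congr_mod oppb0; by rewrite badd0.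
by move=> Jx; apply/esym/piE; rewrite /congr_mod oppb0 badd0.
Qed.

End Quotient.

(** * Exchanges above an arbitrary ideal, by passing to the quotient *)

Section Swap.
Local Open Scope brace_scope.
Variables (B : brace) (J K I : B -> Prop).
Hypotheses (iJ : is_ideal J) (iK : is_ideal K) (iI : is_ideal I).
Hypotheses (JK : forall x, J x -> K x) (KI : forall x, K x -> I x).

Lemma swap_primes p q : prime p -> prime q -> p < q ->
  quot_card K J p -> quot_card I K q ->
  exists Q, [/\ is_ideal Q, forall x, J x -> Q x, forall x, Q x -> I x,
     quot_card Q J q & quot_card I Q p].
Proof.
have [C [pi [piD piM piS piE]]] := quotient_brace iJ.
have pJ := quotient_triv piD piE; have pK := quotient_idealP piE iK JK.
have pI := quotient_idealP piE iI (fun x Jx => KI (JK Jx)).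
move=> p_pr q_pr ltpq /(preimage_card piD piS _ pK pJ) cK /(preimage_card piD piS _ pI pK) cI.
have [||c [x /KI Ix <-]|Q [iQ QI cQ cIQ]] := swap_primes_bottom p_pr q_pr ltpq _ _ _ cK cI.
- exact: (preimage_ideal piD piM piS pI).1 iI.
- exact: (preimage_ideal piD piM piS pK).1 iK.
- by exists x.
have pQ : preimage pi (fun x => Q (pi x)) Q by [].
exists (fun x => Q (pi x)); split.
- exact: (preimage_ideal piD piM piS pQ).2 iQ.
- by move=> x /pJ ->; apply: ideal0.
- by move=> x /QI /pI.
- exact: (preimage_card piD piS q pQ pJ).2 cQ.
- exact: (preimage_card piD piS p pI pQ).2 cIQ.
Qed.

Lemma swap_inf_soc q : prime q -> q != 2 ->
  inf_soc K J -> quot_card I K q ->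
  inf_soc I J \/
  exists Q, [/\ is_ideal Q, forall x, J x -> Q x, forall x, Q x -> I x,
    quot_card Q J q & inf_soc I Q].
Proof.
have [C [pi [piD piM piS piE]]] := quotient_brace iJ.
have pJ := quotient_triv piD piE; have pK := quotient_idealP piE iK JK.
have pI := quotient_idealP piE iI (fun x Jx => KI (JK Jx)).
move=> q_pr q_neq2 /(preimage_inf_soc piD piM piS pK pJ) cK /(preimage_card piD piS _ pI pK) cI.
have [||c [x /KI Ix <-]|IJ|[Q [iQ QI cQ cIQ]]] := swap_inf_soc_bottom q_pr q_neq2 _ _ _ cK cI.
- exact: (preimage_ideal piD piM piS pI).1 iI.
- exact: (preimage_ideal piD piM piS pK).1 iK.
- by exists x.
- by left; apply: (preimage_inf_soc piD piM piS pI pJ).2.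
right; have pQ : preimage pi (fun x => Q (pi x)) Q by [].
exists (fun x => Q (pi x)); split.
- exact: (preimage_ideal piD piM piS pQ).2 iQ.
- by move=> x /pJ ->; apply: ideal0.
- by move=> x /QI /pI.
- exact: (preimage_card piD piS q pQ pJ).2 cQ.
- exact: (preimage_inf_soc piD piM piS pI pQ).2 cIQ.
Qed.

(** The last two clauses identify I' as 2I + K, so that the second doubling can be recognised as 4I
    + K. *)
Lemma inf_soc_double : inf_soc I K ->
  exists I', [/\ is_ideal I', forall x, K x -> I' x, forall x, I' x -> I x,
    inf_soc I' K & quot_card I I' 2] /\
    [/\ forall x, I' x -> exists2 y, I y & congr_mod K (y + y) x
    & forall y, I y -> I' (y + y)].
Proof.
have [C [pi [piD piM piS piE]]] := quotient_brace iK.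
have pK := quotient_triv piD piE; have pI := quotient_idealP piE iI KI.
move=> /(preimage_inf_soc piD piM piS pI pK) cI.
have [|Q [iQ Q2 I2 cQ cIQ]] := inf_soc_double_bottom _ cI.
  exact: (preimage_ideal piD piM piS pI).1 iI.
have pQ : preimage pi (fun x => Q (pi x)) Q by [].
exists (fun x => Q (pi x)); split; split.
- exact: (preimage_ideal piD piM piS pQ).2 iQ.
- by move=> x /pK ->; apply: ideal0.
- move=> x /Q2[y Py ey]; apply/pI; rewrite ey.
  by apply: (idealD ((preimage_ideal piD piM piS pI).1 iI)).
- exact: (preimage_inf_soc piD piM piS pQ pK).2 cQ.
- exact: (preimage_card piD piS 2 pI pQ).2 cIQ.
- move=> x /Q2[_ [y Iy <-] ey]; exists y => //.
  by apply/piE; rewrite piD.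
- by move=> y /pI Iy; rewrite piD; apply: I2.
Qed.
End Swap.

Section SwapTwo.
Local Open Scope brace_scope.
Variables (B : brace) (J K I : B -> Prop).
Hypotheses (iJ : is_ideal J) (iK : is_ideal K) (iI : is_ideal I).
Hypotheses (JK : forall x, J x -> K x) (KI : forall x, K x -> I x).

(** Doubling twice above K gives I4 = 4I + K and I2 = 2I + K. The exchange modulo J replaces K below
    I4 by N; the factors of order 2 are I4/N, I2/I4 and I/I2. *)
Lemma swap_two_inf_soc : quot_card K J 2 -> inf_soc I K ->
  exists N1 N2 N3, [/\ is_ideal N1, is_ideal N2 & is_ideal N3] /\
    [/\ forall x, J x -> N1 x, forall x, N1 x -> N2 x, forall x, N2 x -> N3 x
       & forall x, N3 x -> I x] /\
    [/\ inf_soc N1 J, quot_card N2 N1 2, quot_card N3 N2 2 & quot_card I N3 2].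
Proof.
move=> cK cI.
have [I2 [[iI2 KI2 I2I cI2 cII2] [I2E I2D]]] := inf_soc_double iK iI KI cI.
have [I4 [[iI4 KI4 I4I2 cI4 cI2I4] [I4E I4D]]] := inf_soc_double iK iI2 KI2 cI2.
have JI4 x : J x -> I4 x by move/JK/KI4.
have [C [pi [piD piM piS piE]]] := quotient_brace iJ.
have pJ := quotient_triv piD piE; have pK := quotient_idealP piE iK JK.
have pI := quotient_idealP piE iI (fun x Jx => KI (JK Jx)).
have pI4 := quotient_idealP piE iI4 JI4.
have idl L P := (@preimage_ideal B C pi piD piM piS L P).
have quadE x : nmul x 4 = x + x + (x + x) :> B by rewrite /= baddr0 !baddA.
have [c [x /KI4 I4x <-]|c [x /I4I2/I2I Ix <-]|||c [y Iy <-]|c [x I4x <-]|N [iN NI4 cN cI4N]] :=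
  swap_two_inf_soc_bottom ((idl _ _ pI).1 iI) ((idl _ _ pK).1 iK) ((idl _ _ pI4).1 iI4).
- by exists x.
- by exists x.
- exact: (preimage_card piD piS _ pK pJ).1 cK.
- exact: (preimage_inf_soc piD piM piS pI pK).1 cI.
- by rewrite -(morph_nmul piD); apply/pI4; rewrite quadE; apply/I4D/I2D.
- have [y I2y y2] := I4E x I4x; have [z Iz z2] := I2E y I2y.
  exists (pi z); first by exists z.
  rewrite -(morph_nmul piD); apply/(preimage_congr piD _ _ pK); rewrite quadE.
  by apply: (congr_trans iK) y2; apply: congrD.
have pN : preimage pi (fun x => N (pi x)) N by [].
exists (fun x => N (pi x)), I4, I2; split; first by split=> //; apply: (idl _ _ pN).2 iN.
split; first by split=> // x; [move/pJ => ->; apply: ideal0 | move/NI4/pI4].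
split=> //; first exact: (preimage_inf_soc piD piM piS pN pJ).2 cN.
exact: (preimage_card piD piS 2 pI4 pN).2 cI4N.
Qed.
End SwapTwo.

(** * Sorting chains *)

Section Sorting.
Variable B : brace.
Implicit Types (I J K : B -> Prop).

Definition above J I := is_ideal I /\ forall x, J x -> I x.

(** The index is a lower bound for all primes used so far; a step with q demands the bound q below
    it, which makes the primes weakly decrease upwards. *)
Inductive odd_chain : nat -> (B -> Prop) -> Prop :=
| OddBase p J : (forall x, J x <-> x = bzero B) -> odd_chain p J
| OddStep p q J I : odd_chain q J -> prime q -> q != 2 -> p <= q ->
    above J I -> quot_card I J q -> odd_chain p I.

Inductive odd_inf_chain : (B -> Prop) -> Prop :=
| OddInfBase J : odd_chain 0 J -> odd_inf_chain J
| OddInfStep J I : odd_inf_chain J -> above J I -> inf_soc I J -> odd_inf_chain I.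

Inductive sorted_chain : (B -> Prop) -> Prop :=
| SortedBase J : odd_inf_chain J -> sorted_chain J
| SortedStep J I : sorted_chain J -> above J I -> quot_card I J 2 -> sorted_chain I.

Lemma odd_chain_ideal p J : odd_chain p J -> is_ideal J.
Proof.
case=> [{}p {}J J0|? ? ? ? _ _ _ _ [] //].
have -> : J = triv (bzero B) by apply/predeqP.
exact: ideal_triv.
Qed.

Lemma odd_inf_chain_ideal J : odd_inf_chain J -> is_ideal J.
Proof. by case=> [? /odd_chain_ideal //|? ? _ []]. Qed.

Lemma sorted_chain_ideal J : sorted_chain J -> is_ideal J.
Proof. by case=> [? /odd_inf_chain_ideal //|? ? _ []]. Qed.

(** The new prime sinks past every smaller one. It may itself be below the old bound p, whence
    [minn p q]. *)
Lemma odd_chain_insert p q J I : odd_chain p J -> prime q -> q != 2 ->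
  above J I -> quot_card I J q -> odd_chain (minn p q) I.
Proof.
move=> cJ q_pr q2; elim: cJ I => {p J} [p J J0|p r J0 J cJ0 IH r_pr r2 le_pr J0J cJ] I JI cI.
  by apply: (OddStep (OddBase q J0)) JI cI => //; apply: geq_minr.
have [le_qr|lt_rq] := leqP q r.
  apply: (@OddStep _ q J) JI cI => //; last exact: geq_minr.
  exact: (OddStep cJ0 r_pr r2 le_qr J0J cJ).
have [iJ J0J'] := J0J; have [iI JI'] := JI.
have [Q [iQ J0Q QI cQ cIQ]] :=
  swap_primes (odd_chain_ideal cJ0) iJ iI J0J' JI' r_pr q_pr lt_rq cJ cI.
(* As r < q, the chain up to Q keeps the bound r, so the factor of order r fits on top of it. *)
have := IH Q (conj iQ J0Q) cQ; rewrite (minn_idPl (ltnW lt_rq)) => cQ'.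
by apply: (OddStep cQ') cIQ => //; rewrite geq_min le_pr.
Qed.

Lemma odd_inf_chain_insert q J I : odd_inf_chain J -> prime q -> q != 2 ->
  above J I -> quot_card I J q -> odd_inf_chain I.
Proof.
move=> cJ q_pr q2; elim: cJ I => {J} [J cJ|J0 J cJ0 IH [iJ J0J] cJ] I [iI JI] cI.
  by apply: OddInfBase; rewrite -(min0n q); apply: odd_chain_insert cI.
have [cIJ0|[Q [iQ J0Q QI cQ cIQ]]] :=
  swap_inf_soc (odd_inf_chain_ideal cJ0) iJ iI J0J JI q_pr q2 cJ cI.
  (* The odd factor has been absorbed, so nothing remains to be inserted below. *)
  by apply: OddInfStep cJ0 _ cIJ0; split=> // x /J0J/JI.
by apply: OddInfStep (IH Q _ cQ) _ cIQ.
Qed.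

Lemma sorted_chain_insert_odd q J I : sorted_chain J -> prime q -> q != 2 ->
  above J I -> quot_card I J q -> sorted_chain I.
Proof.
move=> cJ q_pr q2; elim: cJ I => {J} [J cJ|J0 J cJ0 IH [iJ J0J] cJ] I [iI JI] cI.
  by apply: SortedBase; apply: odd_inf_chain_insert cI.
have lt2q : 2 < q by rewrite ltn_neqAle eq_sym q2 prime_gt1.
have [Q [iQ J0Q QI cQ cIQ]] :=
  swap_primes (sorted_chain_ideal cJ0) iJ iI J0J JI (isT : prime 2) q_pr lt2q cJ cI.
by apply: SortedStep (IH Q _ cQ) _ cIQ.
Qed.

(** The recursive call concerns the shorter chain up to J0; the three factors of order 2 stay above
    it. *)
Lemma sorted_chain_insert_inf J I : sorted_chain J ->
  above J I -> inf_soc I J -> sorted_chain I.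
Proof.
move=> cJ; elim: cJ I => {J} [J cJ|J0 J cJ0 IH [iJ J0J] cJ] I [iI JI] cI.
  by apply: SortedBase; apply: OddInfStep cI.
have [N1 [N2 [N3 [[iN1 iN2 iN3] [[J0N1 N12 N23 N3I] [c1 c2 c3 c4]]]]]] :=
  swap_two_inf_soc (sorted_chain_ideal cJ0) iJ iI J0J JI cJ cI.
apply: SortedStep c4 => //; apply: SortedStep c3 => //; apply: SortedStep c2 => //.
exact: IH c1.
Qed.

Lemma supersoluble_sorted_chain :
  supersoluble B -> exists2 J, sorted_chain J & forall x, J x.
Proof.
move=> [len [I [[I0 Ilen iI incI] stepI]]].
exists (I len) => //.
suff : forall k, k <= len -> sorted_chain (I k) by apply.
elim=> [|k IHk] lek; first by apply/SortedBase/OddInfBase/OddBase.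
have abv : above (I k) (I k.+1) by split; [apply: iI | move=> x; exact: incI].
have [cI|[p [p_pr cI]]] := stepI k lek.
  exact: sorted_chain_insert_inf (IHk (ltnW lek)) abv cI.
have [p2|p2] := eqVneq p 2; first by rewrite p2 in cI; apply: SortedStep (IHk (ltnW lek)) abv cI.
exact: sorted_chain_insert_odd (IHk (ltnW lek)) p_pr p2 abv cI.
Qed.

End Sorting.

(** * From inductive chains to indexed families of ideals *)

Section Realization.
Variable B : brace.
Implicit Types (J K : B -> Prop) (I : nat -> B -> Prop).

(** The end is given by an equality of predicates, so it can be rewritten inside statements about
    the next factor. *)
Definition chain_to (I : nat -> B -> Prop) len J :=
  [/\ forall x, I 0 x <-> x = bzero B, I len = J,
      forall k, k <= len -> is_ideal (I k)
    & forall k x, k < len -> I k x -> I k.+1 x].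

Definition extend (T : Type) len (f : nat -> T) y k := if k <= len then f k else y.

Lemma extend_le T len (f : nat -> T) y k : k <= len -> extend len f y k = f k.
Proof. by rewrite /extend => ->. Qed.

Lemma extend_last T len (f : nat -> T) y : extend len f y len.+1 = y.
Proof. by rewrite /extend ltnn. Qed.

Lemma chain_to_extend (I : nat -> B -> Prop) len J K : chain_to I len J -> above J K ->
  chain_to (extend len I K) len.+1 K.
Proof.
move=> [I0 IJ iI incI] [iK JK]; split=> [|||k x].
- by rewrite extend_le.
- exact: extend_last.
- by move=> k _; rewrite /extend; case: ifP => // /iI.
rewrite ltnS leq_eqVlt => /orP[/eqP->|lt_k].
  by rewrite extend_last extend_le // IJ; apply: JK.
by rewrite !extend_le //; [apply: incI | apply: ltnW].
Qed.

Definition odd_part (I : nat -> B -> Prop) (p : nat -> nat) l :=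
  (forall i, i < l -> [/\ prime (p i), p i != 2 & quot_card (I i.+1) (I i) (p i)]) /\
  (forall i, i.+1 < l -> p i.+1 <= p i).

Lemma odd_part_extend (I : nat -> B -> Prop) p l len K : l <= len -> odd_part I p l ->
  odd_part (extend len I K) p l.
Proof.
move=> le_l [cI pI]; split=> // i lt_il.
by rewrite !extend_le; [apply: cI | lia | lia].
Qed.

(** The bound on all p i is what gives the last inequality when a new smallest prime is appended. *)
Lemma odd_chain_realize b J : odd_chain b J -> exists l I p,
  [/\ chain_to I l J, odd_part I p l & forall i, i < l -> b <= p i].
Proof.
elim=> {b J} [b J J0|b q J K _ [l [I [p [cI [oI pI] bI]]]] q_pr q2 le_bq JK cK].
  exists 0, (fun=> J), (fun=> b); split=> //; split=> // k _.
  exact: odd_chain_ideal (OddBase b J0).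
have [_ IJ _ _] := cI.
exists l.+1, (extend l I K), (fun i => if i < l then p i else q).
split; [exact: chain_to_extend cI JK | split=> i | move=> i].
- rewrite ltnS leq_eqVlt => /orP[/eqP->|lt_i].
    by rewrite ltnn extend_last extend_le // IJ.
  by rewrite lt_i !extend_le //; [apply: oI | apply: ltnW].
- by rewrite ltnS => lt_i; rewrite lt_i; case: ltnP => [/pI|_] //; apply: bI.
- by move=> _; case: ltnP => // /bI; apply: leq_trans.
Qed.

Lemma odd_inf_chain_realize J : odd_inf_chain J -> exists l m I p,
  [/\ chain_to I (l + m) J, odd_part I p l
    & forall i, l <= i < l + m -> inf_soc (I i.+1) (I i)].
Proof.
elim=> {J} [J /odd_chain_realize[l [I [p [cI oI _]]]]|J K _ [l [m [I [p [cI oI sI]]]]] JK cK].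
  by exists l, 0, I, p; rewrite addn0; split=> // i; lia.
have [_ IJ _ _] := cI.
exists l, m.+1, (extend (l + m) I K), p; rewrite addnS.
split; [exact: chain_to_extend cI JK | by apply: odd_part_extend oI; lia |] => i.
rewrite ltnS => /andP[le_li]; rewrite leq_eqVlt => /orP[/eqP->|lt_i].
  by rewrite extend_last extend_le // IJ.
by rewrite !extend_le; [apply: sI; lia | lia | lia].
Qed.

Lemma sorted_chain_realize J : sorted_chain J -> exists l m n I p,
  [/\ chain_to I (l + m + n) J, odd_part I p l,
    forall i, l <= i < l + m -> inf_soc (I i.+1) (I i)
    & forall i, l + m <= i < l + m + n -> quot_card (I i.+1) (I i) 2].
Proof.
elim=> {J} [J /odd_inf_chain_realize[l [m [I [p [cI oI sI]]]]]
  |J K _ [l [m [n [I [p [cI oI sI tI]]]]]] JK cK].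
  by exists l, m, 0, I, p; rewrite addn0; split=> // i; lia.
have [_ IJ _ _] := cI.
exists l, m, n.+1, (extend (l + m + n) I K), p; rewrite addnS.
split; [exact: chain_to_extend cI JK | by apply: odd_part_extend oI; lia | |] => i.
  by move=> i_bnd; rewrite !extend_le; [apply: sI | lia | lia].
rewrite ltnS => /andP[le_li]; rewrite leq_eqVlt => /orP[/eqP->|lt_i].
  by rewrite extend_last extend_le // IJ.
by rewrite !extend_le; [apply: tI; lia | lia | lia].
Qed.

End Realization.

(* Chain indexed 0..l+m+n: I_{0,i} = I i, I_{1,i} = I (l+i), I_{2,i} = I (l+m+i). *)
Theorem theorem3p11 (B : brace) :
  supersoluble B ->
  exists (l m n : nat) (I : nat -> B -> Prop) (p : nat -> nat),
    [/\ ideal_chain I (l + m + n),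
        (forall i, i < l ->
           [/\ prime (p i), p i != 2 & quot_card (I i.+1) (I i) (p i)]),
        (forall i, i.+1 < l -> p i.+1 <= p i),
        (forall i, l <= i < l + m ->
           quot_in_soc (I i.+1) (I i) /\ quot_inf_cyclic (I i.+1) (I i))
      & (forall i, l + m <= i < l + m + n -> quot_card (I i.+1) (I i) 2)].
Proof.
move=> /supersoluble_sorted_chain[J].
move=> /sorted_chain_realize[l [m [n [I [p [[I0 IJ iI incI] [oI pI] sI tI]]]]]] fullJ.
exists l, m, n, I, p; split=> //; first by split=> // x; rewrite IJ.
by move=> i /sI[].
Qed.
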